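(* Let $k$ be an algebraically closed field of characteristic zero and let $G$ be a finite group. The map $\Theta:\mathrm{H}^2_\ell(G)\to\mathcal{B}(G)$ enjoys the following properties. (a) The fibres of $\Theta:\mathrm{H}^2_\ell(G)\to\mathcal{B}(G)$ are the left cosets of (the subgroup of $\mathrm{H}^2_\ell(G)$ identified with) $\mathrm{Int}_k(G)/\mathrm{Inn}(G)$. (b) The subset $\Theta^{-1}(1)$ is a subgroup of $\mathrm{H}^2_\ell(G)$ isomorphic to $\mathrm{Int}_k(G)/\mathrm{Inn}(G)$. (c) If the order of $G$ is odd, then any element $(A,b)$ of $\mathcal{B}(G)$ is of the form $\Theta(F)$ for an invariant twist $F$ which is supported by $A$. In particular, $\Theta$ is surjective in this case.
   Context: Twists: $k[G]$ is the group algebra with coproduct $\Delta(g)=g\otimes g$ for $g\in G$. A twist on $k[G]$ is an invertible element $F\in k[G]\otimes k[G]$ with $(F\otimes 1)(\Delta\otimes\mathrm{id})(F)=(1\otimes F)(\mathrm{id}\otimes\Delta)(F)$. It is invariant if $\Delta(a)F=F\Delta(a)$ for all $a\in k[G]$. Invariant twists form a group $Z^2$ under multiplication. For $a$ in the group $A^1$ of invertible central elements of $k[G]$ put $\delta^1(a)=(a\otimes a)\Delta(a^{-1})$; $\delta^1$ is a homomorphism onto a central subgroup of $Z^2$, and $\mathrm{H}^2_\ell(G)=Z^2/\delta^1(A^1)$. Automorphisms: $\mathrm{Int}_k(G)$ is the group of automorphisms of $G$ of the form $g\mapsto aga^{-1}$ with $a$ in the normalizer $N_k(G)$ of $G$ in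 $k[G]^\times$; it contains the inner automorphism group $\mathrm{Inn}(G)$. The map $a\mapsto (a\otimes a)\Delta(a^{-1})$, $a\in N_k(G)$, induces an injective group homomorphism $\mathrm{Int}_k(G)/\mathrm{Inn}(G)\cong N_k(G)/(A^1 G)\hookrightarrow \mathrm{H}^2_\ell(G)$, through which $\mathrm{Int}_k(G)/\mathrm{Inn}(G)$ is viewed as a subgroup of $\mathrm{H}^2_\ell(G)$. The set $\mathcal{B}(G)$: for a finite abelian group $A$ let $\widehat A=\mathrm{Hom}(A,k^\times)$. $\mathcal{B}(G)$ is the set of pairs $(A,b)$ where $A$ is an abelian normal subgroup of $G$ and $b:\widehat A\times\widehat A\to k^\times$ is a bilinear form that is alternating ($b(\chi,\chi)=1$ for all $\chi$), non-degenerate, and invariant under the action of $G$ on $\widehat A$ induced by conjugation. It is a pointed set with distinguished element $1=(\{1\},1)$, the trivial form on the trivial subgroup. The map $\Theta$: for $\rho\in\widehat A$ let $e_\rho\in k[A]$ be the corresponding primitive idempotent, so that (extending characters linearly to $k[A]$) $\sigma(e_\rho)=\delta_{\sigma,\rho}$; for a bilinear form $b$ on $\widehat A$ put $R(A,b)=\sum_{\sigma,\tau\in\widehat A} b(\sigma,\tau)\,e_\sigma\otimes e_\tau\in k[A]\otimes k[A]$. For an invariant twist $F$ let $R_F=F_{21}F^{-1}$, where $F_{21}$ is the image of $F$ under the flip of tensor factors; $R_F$ is a universal $R$-matrix for $k[G]$ and depends only on the class of $F$ in $\mathrm{H}^2_\ell(G)$. The smallest Hopf subalgebra $H'$ of $k[G]$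 with $R_F\in H'\otimes H'$ is $k[A]$ for a unique subgroup $A$ of $G$, which is abelian and normal, and there is a unique $b$ with $(A,b)\in\mathcal{B}(G)$ and $R_F=R(A,b)$. One sets $\Theta(F)=(A,b)$ (this depends only on the class of $F$). Such an $F$ is said to be supported by $A$ if moreover $F\in k[A]\otimes k[A]$. *)

(* Defs.v *)
From HB Require Import structures.
From mathcomp Require Import all_boot all_order all_fingroup all_algebra cyclic falgebra.
From mathcomp Require Import boolp classical_sets.
Set Implicit Arguments.
Unset Strict Implicit.
Unset Printing Implicit Defensive.
Import GRing.Theory.
Local Open Scope ring_scope.

(* The group algebra k[G], by coordinates on the basis G.  {ffun G -> k^o}    *)
(* already has a pointwise product; the alias carries the convolution product. *)
Definition galg (k : fieldType) (G : finGroupType) : Type := {ffun G -> k^o}.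
HB.instance Definition _ k G := Vector.copy (galg k G) {ffun G -> k^o}.

Section GroupAlgebra.
Variables (k : fieldType) (G : finGroupType).
Implicit Types (a b c : galg k G) (g h : G).

Definition gcoef a g : k := (a : {ffun G -> k^o}) g.

Definition gelt g : galg k G := [ffun x => (x == g)%:R].

Definition gmul a b : galg k G := [ffun g => \sum_x gcoef a x * gcoef b (x^-1 * g)%g].

Lemma galgP a b : (forall g, gcoef a g = gcoef b g) -> a = b.
Proof. by move=> ab; apply/ffunP=> g; exact: ab. Qed.

Lemma gcoefD a b g : gcoef (a + b) g = gcoef a g + gcoef b g.
Proof. by rewrite /gcoef ffunE. Qed.

Lemma gcoefZ (x : k) a g : gcoef (x *: a) g = x * gcoef a g.
Proof. by rewrite /gcoef ffunE. Qed.

Lemma gcoef_sum (I : Type) (r : seq I) (P : pred I) (F : I -> galg k G) g :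
  gcoef (\sum_(i <- r | P i) F i) g = \sum_(i <- r | P i) gcoef (F i) g.
Proof. by elim/big_rec2: _ => [|i y1 y2 _ <-]; rewrite ?gcoefD// /gcoef ffunE. Qed.

Lemma gcoef_gelt h g : gcoef (gelt h) g = (g == h)%:R.
Proof. by rewrite /gcoef ffunE. Qed.

Lemma gcoef_mul a b g :
  gcoef (gmul a b) g = \sum_x gcoef a x * gcoef b (x^-1 * g)%g.
Proof. by rewrite /gcoef ffunE. Qed.

Fact gmulA : associative gmul.
Proof.
move=> a b c; apply: galgP => g; rewrite !gcoef_mul.
under eq_bigr do rewrite gcoef_mul mulr_sumr.
under [RHS]eq_bigr do rewrite gcoef_mul mulr_suml.
rewrite [RHS]exchange_big /=; apply: eq_bigr => x _.
rewrite [RHS](reindex (fun y => x * y)%g) /=; last first.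
  by exists (fun y => x^-1 * y)%g => y _; rewrite ?mulKg ?mulKVg.
by apply: eq_bigr => y _; rewrite mulKg invMg mulrA mulgA.
Qed.

Fact gmul1l : left_id (gelt 1) gmul.
Proof.
move=> a; apply: galgP => g; rewrite gcoef_mul (bigD1 1%g) //= big1 ?addr0.
  by rewrite gcoef_gelt eqxx mul1r invg1 mul1g.
by move=> x /negPf x1; rewrite gcoef_gelt x1 mul0r.
Qed.

Fact gmul1r : right_id (gelt 1) gmul.
Proof.
move=> a; apply: galgP => g; rewrite gcoef_mul (bigD1 g) //= big1 ?addr0.
  by rewrite gcoef_gelt mulVg eqxx mulr1.
move=> x /negPf x1; rewrite gcoef_gelt -(inj_eq (mulgI x)) mulKVg mulg1 eq_sym.
by rewrite x1 mulr0.
Qed.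

Fact gmulDl : left_distributive gmul +%R.
Proof.
move=> a b c; apply: galgP => g; rewrite gcoefD !gcoef_mul -big_split /=.
by apply: eq_bigr => x _; rewrite gcoefD mulrDl.
Qed.

Fact gmulDr : right_distributive gmul +%R.
Proof.
move=> a b c; apply: galgP => g; rewrite gcoefD !gcoef_mul -big_split /=.
by apply: eq_bigr => x _; rewrite gcoefD mulrDr.
Qed.

Fact gelt1_neq0 : gelt 1 != 0.
Proof.
apply/eqP => /(congr1 (gcoef^~ 1%g)); rewrite gcoef_gelt eqxx /gcoef ffunE.
by move/eqP; rewrite oner_eq0.
Qed.

HB.instance Definition _ := GRing.Zmodule_isNzRing.Build (galg k G)
  gmulA gmul1l gmul1r gmulDl gmulDr gelt1_neq0.

Fact gscaleAl (x : k) (a b : galg k G) : x *: (a * b) = (x *: a) * b.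
Proof.
apply: galgP => g; rewrite gcoefZ !gcoef_mul mulr_sumr.
by apply: eq_bigr => y _; rewrite gcoefZ mulrA.
Qed.
HB.instance Definition _ := GRing.Lmodule_isLalgebra.Build k (galg k G) gscaleAl.

Fact gscaleAr (x : k) (a b : galg k G) : x *: (a * b) = a * (x *: b).
Proof.
apply: galgP => g; rewrite gcoefZ !gcoef_mul mulr_sumr.
by apply: eq_bigr => y _; rewrite gcoefZ mulrCA.
Qed.
HB.instance Definition _ := GRing.Lalgebra_isAlgebra.Build k (galg k G) gscaleAr.
HB.instance Definition _ := Algebra_isFalgebra.Build k (galg k G).

Lemma gelt1 : gelt 1 = 1. Proof. by []. Qed.

Lemma geltM g h : gelt (g * h)%g = gelt g * gelt h.
Proof.
apply: galgP => x; rewrite gcoef_mul (bigD1 g) //= big1 ?addr0.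
  by rewrite !gcoef_gelt eqxx mul1r -[in RHS](inj_eq (mulgI g)) mulKVg.
by move=> y /negPf y1; rewrite gcoef_gelt y1 mul0r.
Qed.

Lemma galgE a : a = \sum_g gcoef a g *: gelt g.
Proof.
apply: galgP => x; rewrite gcoef_sum (bigD1 x) //= big1 ?addr0.
  by rewrite gcoefZ gcoef_gelt eqxx mulr1.
by move=> y /negPf y1; rewrite gcoefZ gcoef_gelt eq_sym y1 mulr0.
Qed.

Lemma gmulE a b :
  a * b = \sum_g \sum_h (gcoef a g * gcoef b h) *: gelt (g * h)%g.
Proof.
rewrite {1}(galgE a) mulr_suml; apply: eq_bigr => g _.
rewrite {1}(galgE b) mulr_sumr; apply: eq_bigr => h _.
by rewrite -scalerAl -scalerAr scalerA geltM.
Qed.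

Lemma geltV g : gelt g \is a GRing.unit /\ (gelt g)^-1 = gelt g^-1%g.
Proof.
have gV : gelt g * gelt g^-1%g = 1 by rewrite -geltM mulgV.
have Vg : gelt g^-1%g * gelt g = 1 by rewrite -geltM mulVg.
have ug : gelt g \is a GRing.unit by apply/unitrP; exists (gelt g^-1%g).
by split=> //; rewrite -[LHS]mulr1 -gV mulKr.
Qed.

Lemma gelt_inj : injective gelt.
Proof.
move=> g h /(congr1 (gcoef^~ g)); rewrite !gcoef_gelt eqxx.
by case: eqP => // _ /eqP; rewrite oner_eq0.
Qed.

End GroupAlgebra.
Arguments gelt {k G} g.

Section Functoriality.
Variables (k : fieldType) (G H : finGroupType).

(* The k-linear extension of a map between groups. *)
Definition gext (f : G -> H) (a : galg k G) : galg k H :=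
  \sum_g gcoef a g *: gelt (f g).

Fact gext_is_linear f : linear (gext f).
Proof.
move=> x a b; rewrite /gext scaler_sumr -big_split /=; apply: eq_bigr => g _.
by rewrite gcoefD gcoefZ scalerDl scalerA.
Qed.
HB.instance Definition _ f :=
  GRing.isLinear.Build k (galg k G) (galg k H) *:%R (gext f) (gext_is_linear f).

Lemma gext_gelt f g : gext f (gelt g) = gelt (f g).
Proof.
rewrite /gext (bigD1 g) //= big1 ?addr0 ?gcoef_gelt ?eqxx ?scale1r // => h.
by move=> /negPf hg; rewrite gcoef_gelt hg scale0r.
Qed.

Section Morph.
Variables (f : G -> H) (fM : {morph f : x y / (x * y)%g}).

Lemma gextM : {morph gext f : a b / a * b}.
Proof.
move=> a b; rewrite gmulE linear_sum /= [RHS]mulr_suml; apply: eq_bigr => g _.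
rewrite linear_sum /= mulr_sumr; apply: eq_bigr => h _.
by rewrite linearZ /= gext_gelt fM geltM -scalerAl -scalerAr scalerA.
Qed.

Lemma gext1 : gext f 1 = 1.
Proof.
rewrite -gelt1 gext_gelt -gelt1; congr gelt.
by apply: (mulgI (f 1%g)); rewrite -fM !mulg1.
Qed.

Lemma gext_unit a : a \is a GRing.unit -> gext f a \is a GRing.unit.
Proof.
move=> ua; apply/unitrP; exists (gext f a^-1).
by rewrite -!gextM mulVr // divrr // gext1.
Qed.

Lemma gextV a : a \is a GRing.unit -> gext f a^-1 = (gext f a)^-1.
Proof.
move=> ua; apply: (mulrI (gext_unit ua)).
by rewrite -gextM !divrr ?gext_unit // gext1.
Qed.

End Morph.
End Functoriality.

Lemma gext_comp (k : fieldType) (G H K : finGroupType) (f : H -> K) (f' : G -> H)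
  (a : galg k G) : gext f (gext f' a) = gext (f \o f') a.
Proof.
rewrite [gext f' a]/gext linear_sum; apply: eq_bigr => g _.
by rewrite linearZ /= gext_gelt.
Qed.

Section Tensor.
Variables (k : fieldType) (G : finGroupType).
Implicit Types (a b c d : galg k G).

(* k[G] (x) k[G] is identified with k[G * G], where g (x) h is the basis       *)
(* element (g, h), and likewise the triple tensor product with k[G * G * G].   *)
Definition tens a b : galg k (G * G)%type := [ffun p => gcoef a p.1 * gcoef b p.2].

Definition coprod : galg k G -> galg k (G * G)%type := gext (fun g => (g, g)).
Definition antipode : galg k G -> galg k G := gext (fun g => g^-1%g).
Definition flip : galg k (G * G)%type -> galg k (G * G)%type :=
  gext (fun p => (p.2, p.1)).
(* leg12 F = F (x) 1, leg23 F = 1 (x) F, coprod_id = Delta (x) id and          *)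
(* id_coprod = id (x) Delta.                                                   *)
Definition leg12 : galg k (G * G)%type -> galg k (G * G * G)%type :=
  gext (fun p => (p.1, p.2, 1%g)).
Definition leg23 : galg k (G * G)%type -> galg k (G * G * G)%type :=
  gext (fun p => (1%g, p.1, p.2)).
Definition coprod_id : galg k (G * G)%type -> galg k (G * G * G)%type :=
  gext (fun p => (p.1, p.1, p.2)).
Definition id_coprod : galg k (G * G)%type -> galg k (G * G * G)%type :=
  gext (fun p => (p.1, p.2, p.2)).

Lemma gcoef_tens a b p : gcoef (tens a b) p = gcoef a p.1 * gcoef b p.2.
Proof. by rewrite /gcoef ffunE. Qed.

Lemma tensE a b : tens a b =
  \sum_g \sum_h (gcoef a g * gcoef b h) *: gelt (g, h).
Proof.
rewrite (galgE (tens a b)) pair_big_dep /=; apply: eq_bigr => -[g h] _ /=.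
by rewrite gcoef_tens.
Qed.

Lemma tens_gelt g h : tens (gelt g) (gelt h) = gelt (g, h).
Proof.
apply: galgP => -[x y]; rewrite gcoef_tens !gcoef_gelt /= -pair_eqE /=.
by rewrite -natrM mulnb.
Qed.

Lemma tensDl a b c : tens (a + b) c = tens a c + tens b c.
Proof. by apply: galgP => p; rewrite gcoefD !gcoef_tens gcoefD mulrDl. Qed.
Lemma tensDr a b c : tens a (b + c) = tens a b + tens a c.
Proof. by apply: galgP => p; rewrite gcoefD !gcoef_tens gcoefD mulrDr. Qed.
Lemma tensZl x a b : tens (x *: a) b = x *: tens a b.
Proof. by apply: galgP => p; rewrite gcoefZ !gcoef_tens gcoefZ mulrA. Qed.
Lemma tensZr x a b : tens a (x *: b) = x *: tens a b.
Proof. by apply: galgP => p; rewrite gcoefZ !gcoef_tens gcoefZ mulrCA. Qed.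

Lemma tensM a b c d : tens a b * tens c d = tens (a * c) (b * d).
Proof.
apply: galgP => -[g h]; rewrite gcoef_mul gcoef_tens /= !gcoef_mul mulr_suml.
under [RHS]eq_bigr do rewrite mulr_sumr.
rewrite pair_big_dep /=; apply: eq_bigr => -[x y] _ /=.
by rewrite !gcoef_tens /= mulrACA.
Qed.

Lemma tens1 : tens 1 1 = 1.
Proof. by rewrite -gelt1 tens_gelt. Qed.

Lemma tens_l a : tens a 1 = gext (fun g => (g, 1%g)) a.
Proof.
rewrite tensE; apply: eq_bigr => g _; rewrite (bigD1 1%g) //= big1 ?addr0.
  by rewrite -gelt1 gcoef_gelt eqxx mulr1.
by move=> h /negPf h1; rewrite -gelt1 gcoef_gelt h1 mulr0 scale0r.
Qed.

Lemma tens_r a : tens 1 a = gext (fun g => (1%g, g)) a.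
Proof.
rewrite tensE exchange_big; apply: eq_bigr => g _ /=.
rewrite (bigD1 1%g) //= big1 ?addr0.
  by rewrite -gelt1 gcoef_gelt eqxx mul1r.
by move=> h /negPf h1; rewrite -gelt1 gcoef_gelt h1 mul0r scale0r.
Qed.

Lemma tens_unit a : a \is a GRing.unit ->
  tens a a \is a GRing.unit /\ (tens a a)^-1 = tens a^-1 a^-1.
Proof.
move=> ua; have aV : tens a a * tens a^-1 a^-1 = 1.
  by rewrite tensM !divrr // tens1.
have uta : tens a a \is a GRing.unit.
  by apply/unitrP; exists (tens a^-1 a^-1); rewrite aV tensM !mulVr // tens1.
by split=> //; rewrite -[LHS]mulr1 -aV mulKr.
Qed.

End Tensor.

Section Twists.
Variables (k : fieldType) (G : finGroupType).
Implicit Types (a b : galg k G) (F : galg k (G * G)%type).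

Definition is_twist F : Prop :=
  F \is a GRing.unit /\ leg12 F * coprod_id F = leg23 F * id_coprod F.

Definition is_invariant F : Prop := forall a, coprod a * F = F * coprod a.

Definition is_inv_twist F : Prop := is_twist F /\ is_invariant F.

Definition central_unit a : Prop :=
  a \is a GRing.unit /\ forall b, a * b = b * a.

(* a belongs to the normalizer N_k(G) of G in k[G]^x. *)
Definition normalizes a : Prop :=
  a \is a GRing.unit /\
  [set a * x * a^-1 | x in range (@gelt k G)]%classic = range (@gelt k G).

Definition delta a : galg k (G * G)%type := tens a a * coprod a^-1.

Let diagM : {morph (fun g : G => (g, g)) : x y / (x * y)%g}. Proof. by []. Qed.
Let m12 : {morph (fun p : G * G => (p.1, p.2, 1%g : G)) : x y / (x * y)%g}.
Proof. by move=> [x x'] [y y']; congr (_, _, _); rewrite mulg1. Qed.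
Let m23 : {morph (fun p : G * G => (1%g : G, p.1, p.2)) : x y / (x * y)%g}.
Proof. by move=> [x x'] [y y']; congr (_, _, _); rewrite mulg1. Qed.
Let mci : {morph (fun p : G * G => (p.1, p.1, p.2)) : x y / (x * y)%g}.
Proof. by []. Qed.
Let mic : {morph (fun p : G * G => (p.1, p.2, p.2)) : x y / (x * y)%g}.
Proof. by []. Qed.

Lemma comm_ext (K H : finGroupType) (f : K -> H) (x : galg k H) :
  (forall g, gelt (f g) * x = x * gelt (f g)) ->
  forall a : galg k K, gext f a * x = x * gext f a.
Proof.
move=> cf a; rewrite /gext mulr_suml mulr_sumr.
by apply: eq_bigr => g _; rewrite -scalerAl -scalerAr cf.
Qed.

Lemma coprodM : {morph @coprod k G : a b / a * b}.
Proof. exact: gextM. Qed.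
Lemma coprod_gelt g : coprod (@gelt k G g) = gelt (g, g).
Proof. exact: gext_gelt. Qed.

Lemma leg12M : {morph @leg12 k G : a b / a * b}.
Proof. exact: gextM. Qed.
Lemma leg23M : {morph @leg23 k G : a b / a * b}.
Proof. exact: gextM. Qed.
Lemma coprod_idM : {morph @coprod_id k G : a b / a * b}.
Proof. exact: gextM. Qed.
Lemma id_coprodM : {morph @id_coprod k G : a b / a * b}.
Proof. exact: gextM. Qed.

Lemma leg12_coprod_id F F' : is_invariant F ->
  coprod_id F' * leg12 F = leg12 F * coprod_id F'.
Proof.
move=> invF; apply: comm_ext => -[g h] /=.
have -> : (g, g, h) = ((g, g, 1) * (1, 1, h))%g :> G * G * G.
  by congr (_, _, _); rewrite ?mulg1 ?mul1g.
have e1 : gelt (g, g, 1%g) = leg12 (coprod (gelt g)) :> galg k _.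
  by rewrite coprod_gelt /leg12 gext_gelt.
have e2 : gelt (1%g, 1%g, h) * leg12 F = leg12 F * gelt (1%g, 1%g, h).
  apply/esym; apply: comm_ext => -[x y] /=; rewrite -!geltM.
  by congr gelt; congr (_, _, _); rewrite ?mulg1 ?mul1g.
by rewrite geltM -mulrA e2 mulrA e1 -leg12M -invF leg12M mulrA.
Qed.

Lemma leg23_id_coprod F F' : is_invariant F ->
  id_coprod F' * leg23 F = leg23 F * id_coprod F'.
Proof.
move=> invF; apply: comm_ext => -[h g] /=.
have -> : (h, g, g) = ((1, g, g) * (h, 1, 1))%g :> G * G * G.
  by congr (_, _, _); rewrite ?mulg1 ?mul1g.
have e1 : gelt (1%g, g, g) = leg23 (coprod (gelt g)) :> galg k _.
  by rewrite coprod_gelt /leg23 gext_gelt.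
have e2 : gelt (h, 1%g, 1%g) * leg23 F = leg23 F * gelt (h, 1%g, 1%g).
  apply/esym; apply: comm_ext => -[x y] /=; rewrite -!geltM.
  by congr gelt; congr (_, _, _); rewrite ?mulg1 ?mul1g.
by rewrite geltM -mulrA e2 mulrA e1 -leg23M -invF leg23M mulrA.
Qed.

Lemma inv_twist1 : is_inv_twist 1.
Proof.
split; last by move=> a; rewrite mulr1 mul1r.
split; first exact: unitr1.
by rewrite /leg12 /leg23 /coprod_id /id_coprod !gext1.
Qed.

Lemma inv_twistM F F' : is_inv_twist F -> is_inv_twist F' ->
  is_inv_twist (F * F').
Proof.
move=> [[uF cF] iF] [[uF' cF'] iF']; split; last first.
  by move=> a; rewrite mulrA iF -!mulrA iF'.
split; first by rewrite unitrMr.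
rewrite leg12M leg23M coprod_idM id_coprodM.
have reorder (x y z t : galg k (G * G * G)%type) :
  z * y = y * z -> x * y * (z * t) = (x * z) * (y * t).
  by move=> zy; rewrite -!mulrA; congr (_ * _); rewrite !mulrA zy.
rewrite (reorder _ _ _ _ (leg12_coprod_id F iF')).
by rewrite (reorder _ _ _ _ (leg23_id_coprod F iF')) cF cF'.
Qed.

Lemma inv_twistV F : is_inv_twist F -> is_inv_twist F^-1.
Proof.
move=> [[uF cF] iF]; split; last first.
  move=> a; apply: (mulrI uF); rewrite mulrA -iF -mulrA divrr // mulr1.
  by rewrite mulrA divrr // mul1r.
split; first by rewrite unitrV.
have e12 : leg12 F^-1 = (leg12 F)^-1 by apply: gextV.
have e23 : leg23 F^-1 = (leg23 F)^-1 by apply: gextV.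
have eci : coprod_id F^-1 = (coprod_id F)^-1 by apply: gextV.
have eic : id_coprod F^-1 = (id_coprod F)^-1 by apply: gextV.
have u12 : leg12 F \is a GRing.unit by apply: gext_unit.
have u23 : leg23 F \is a GRing.unit by apply: gext_unit.
have uci : coprod_id F \is a GRing.unit by apply: gext_unit.
have uic : id_coprod F \is a GRing.unit by apply: gext_unit.
rewrite e12 e23 eci eic.
rewrite -(invrM uci u12) -(invrM uic u23).
by congr (_^-1); rewrite (leg12_coprod_id F iF) (leg23_id_coprod F iF).
Qed.

Lemma normalizesP a : normalizes a ->
  (forall g, exists h, gelt g * a = a * gelt h) /\
  (forall g, exists h, a * gelt g = gelt h * a).
Proof.
move=> [ua Na]; split=> g.
  have : [set a * x * a^-1 | x in range (@gelt k G)]%classic (gelt g).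
    by rewrite Na; exists g.
  move=> [_ [h _ <-] <-]; exists h.
  by rewrite -!mulrA mulVr // mulr1.
have : range (@gelt k G) (a * gelt g * a^-1).
  by rewrite -Na; exists (gelt g) => //; exists g.
by move=> [h _ hE]; exists h; rewrite hE -!mulrA mulVr // mulr1.
Qed.

Lemma normalizes_of a : a \is a GRing.unit ->
  (forall g, exists h, gelt g * a = a * gelt h) ->
  (forall g, exists h, a * gelt g = gelt h * a) -> normalizes a.
Proof.
move=> ua aG Ga; split=> //; apply/seteqP; split=> [_ [_ [g _ <-] <-]|_ [g _ <-]].
  by have [h hE] := Ga g; exists h => //; rewrite hE -mulrA divrr // mulr1.
have [h hE] := aG g; exists (gelt h); first by exists h.
by rewrite -hE -mulrA divrr // mulr1.
Qed.

Lemma central_normalizes a : central_unit a -> normalizes a.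
Proof.
by move=> [ua ca]; apply: normalizes_of => // g; exists g; rewrite ca.
Qed.

Lemma normalizes1 : normalizes 1.
Proof. by apply: central_normalizes; split=> [|b]; rewrite ?unitr1 // mulr1 mul1r. Qed.

Lemma normalizesM a b : normalizes a -> normalizes b -> normalizes (a * b).
Proof.
move=> Na Nb; have [aG Ga] := normalizesP Na; have [bG Gb] := normalizesP Nb.
apply: normalizes_of.
- by rewrite unitrMr ?Na.1 ?Nb.1.
- move=> g; have [h h1] := aG g; have [h' h2] := bG h; exists h'.
  by rewrite mulrA h1 -mulrA h2 mulrA.
- move=> g; have [h h1] := Gb g; have [h' h2] := Ga h; exists h'.
  by rewrite -mulrA h1 mulrA h2 mulrA.
Qed.

Lemma normalizesV a : normalizes a -> normalizes a^-1.
Proof.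
move=> Na; have [aG Ga] := normalizesP Na; have ua := Na.1.
apply: normalizes_of; first by rewrite unitrV.
  move=> g; have [h hE] := Ga g; exists h; apply: (mulrI ua).
  by rewrite mulrA hE -mulrA divrr // mulr1 mulrA divrr // mul1r.
move=> g; have [h hE] := aG g; exists h; apply: (mulrI ua).
by rewrite mulrA divrr // mul1r mulrA -hE -mulrA divrr // mulr1.
Qed.

Lemma delta_invariant a : normalizes a -> is_invariant (delta a).
Proof.
move=> Na; have [aG _] := normalizesP Na; have ua := Na.1.
apply: comm_ext => g; rewrite /delta -coprod_gelt.
have [h hE] := aG g; have -> : coprod (gelt g) * (tens a a * coprod a^-1) =
    tens a a * (coprod (gelt h) * coprod a^-1).
  rewrite !mulrA; congr (_ * _).
  by rewrite !coprod_gelt -!tens_gelt !tensM hE.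
rewrite -mulrA -!coprodM; congr (_ * coprod _).
by apply: (mulrI ua); rewrite mulrA -hE mulrK // mulVKr.
Qed.

Lemma delta_unit a : a \is a GRing.unit -> delta a \is a GRing.unit.
Proof.
move=> ua; have [uaa _] := tens_unit ua; rewrite (unitrMr _ uaa).
by apply: gext_unit; rewrite ?unitrV.
Qed.

Lemma delta_inv_twist a : normalizes a -> is_inv_twist (delta a).
Proof.
move=> Na; have ua := Na.1; split; last exact: delta_invariant.
split; first exact: delta_unit.
pose r1 := gext (fun g : G => (g, 1%g, 1%g) : G * G * G) a.
pose r2 := gext (fun g : G => (1%g, g, 1%g) : G * G * G) a.
pose r3 := gext (fun g : G => (1%g, 1%g, g) : G * G * G) a.
have E : tens a a = tens a 1 * tens 1 a by rewrite tensM mulr1 mul1r.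
have aV : coprod a^-1 * coprod a = 1.
  by rewrite -coprodM mulVr // /coprod gext1.
have c12 : leg12 (tens a a) = r1 * r2.
  by rewrite E leg12M tens_l tens_r /leg12 !gext_comp.
have c23 : leg23 (tens a a) = r2 * r3.
  by rewrite E leg23M tens_l tens_r /leg23 !gext_comp.
have ci : coprod_id (tens a a) = leg12 (coprod a) * r3.
  by rewrite E coprod_idM tens_l tens_r /coprod_id /leg12 /coprod !gext_comp.
have ic : id_coprod (tens a a) = r1 * leg23 (coprod a).
  by rewrite E id_coprodM tens_l tens_r /id_coprod /leg23 /coprod !gext_comp.
have rC : r1 * (r2 * r3) = r2 * r3 * r1.
  rewrite -c23; apply: comm_ext => g; apply/esym.
  apply: comm_ext => -[x y] /=; rewrite -!geltM.
  by congr gelt; congr (_, _, _); rewrite ?mulg1 ?mul1g.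
have rC' : r1 * leg23 (coprod a) = leg23 (coprod a) * r1.
  apply: comm_ext => g; apply/esym; apply: comm_ext => -[x y] /=.
  by rewrite -!geltM; congr gelt; congr (_, _, _); rewrite ?mulg1 ?mul1g.
have D3 x : coprod_id (coprod x) = id_coprod (coprod x).
  by rewrite /coprod_id /id_coprod /coprod !gext_comp.
rewrite /delta leg12M leg23M coprod_idM id_coprodM D3 c12 c23 ci ic rC'.
have mid (x y y' z w : galg k (G * G * G)%type) :
    y * y' = 1 -> x * y * (y' * z * w) = x * z * w.
  by move=> yy'; rewrite !mulrA -(mulrA x) yy' mulr1.
have V12 : leg12 (coprod a^-1) * leg12 (coprod a) = 1.
  by rewrite -leg12M aV; apply: gext1.
have V23 : leg23 (coprod a^-1) * leg23 (coprod a) = 1.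
  by rewrite -leg23M aV; apply: gext1.
by rewrite (mid _ _ _ _ _ V12) (mid _ _ _ _ _ V23) -(mulrA r1) rC.
Qed.

Lemma deltaM a b : a \is a GRing.unit -> normalizes b ->
  delta (a * b) = delta a * delta b.
Proof.
move=> ua Nb; have ub := Nb.1.
rewrite {1}/delta invrM // -tensM coprodM -mulrA [tens b b * _]mulrA.
by rewrite -/(delta b) -delta_invariant // !mulrA.
Qed.

Lemma delta1 : delta 1 = 1.
Proof. by rewrite /delta invr1 tens1 mul1r /coprod gext1. Qed.

Lemma deltaV a : normalizes a -> delta a^-1 = (delta a)^-1.
Proof.
move=> Na; have ua := Na.1; apply: (mulrI (delta_unit ua)).
by rewrite -deltaM ?divrr ?delta1 ?delta_unit //; apply: normalizesV.
Qed.

Lemma delta_central a F : central_unit a -> is_invariant F ->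
  delta a * F = F * delta a.
Proof.
move=> [ua ca] iF; rewrite /delta -mulrA iF !mulrA; congr (_ * _).
have E : tens a a = tens a 1 * tens 1 a by rewrite tensM mulr1 mul1r.
have c (x y : galg k G) : tens a a * tens x y = tens x y * tens a a.
  by rewrite !tensM ca (ca y).
rewrite (galgE F) mulr_sumr mulr_suml; apply: eq_bigr => -[g h] _.
by rewrite -scalerAl -scalerAr -tens_gelt c.
Qed.

End Twists.

Section Cohomology.
Variables (k : fieldType) (G : finGroupType).

Record inv_twist := InvTwist {
  twist_val :> galg k (G * G)%type;
  twistP : is_inv_twist twist_val }.

HB.instance Definition _ := gen_eqMixin inv_twist.
HB.instance Definition _ := gen_choiceMixin inv_twist.

Lemma twist_val_inj : injective twist_val.
Proof. by move=> [F p] [F' p'] /= e; subst F'; rewrite (Prop_irrelevance p p'). Qed.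

Definition twist_one := InvTwist (inv_twist1 k G).
Definition twist_mul (F F' : inv_twist) :=
  InvTwist (inv_twistM (twistP F) (twistP F')).
Definition twist_inv (F : inv_twist) := InvTwist (inv_twistV (twistP F)).

Let twist_unit (F : inv_twist) : twist_val F \is a GRing.unit.
Proof. by case: F => F [[]]. Qed.

Fact twist_mulA : associative twist_mul.
Proof. by move=> F F' F''; apply: twist_val_inj; rewrite /= mulrA. Qed.
Fact twist_mul1l : left_id twist_one twist_mul.
Proof. by move=> F; apply: twist_val_inj; rewrite /= mul1r. Qed.
Fact twist_mul1r : right_id twist_one twist_mul.
Proof. by move=> F; apply: twist_val_inj; rewrite /= mulr1. Qed.
Fact twist_mulVl : left_inverse twist_one twist_inv twist_mul.
Proof. by move=> F; apply: twist_val_inj; apply: mulVr. Qed.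
Fact twist_mulVr : right_inverse twist_one twist_inv twist_mul.
Proof. by move=> F; apply: twist_val_inj; apply: divrr. Qed.

HB.instance Definition _ := isGroup.Build inv_twist
  twist_mulA twist_mul1l twist_mul1r twist_mulVl twist_mulVr.

Lemma central_unitM (a b : galg k G) :
  central_unit a -> central_unit b -> central_unit (a * b).
Proof.
move=> [ua ca] [ub cb]; split=> [|c]; first by rewrite unitrMr.
by rewrite -mulrA cb mulrA ca -mulrA.
Qed.

Lemma central_unitV (a : galg k G) : central_unit a -> central_unit a^-1.
Proof.
move=> [ua ca]; split=> [|c]; first by rewrite unitrV.
by apply: (mulrI ua); rewrite mulVKr // mulrA ca mulrK.
Qed.

Lemma central_unit1 : central_unit (1 : galg k G).
Proof. by split=> [|b]; rewrite ?unitr1 // mulr1 mul1r. Qed.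

(* The quotient Z^2 / delta^1(A^1); delta^1(A^1) is central in Z^2, so that    *)
(* left and right cosets agree.                                                *)
Definition cohomologous (F F' : inv_twist) : bool :=
  `[< exists2 a, central_unit a & twist_val F' = twist_val F * delta a >].

Fact cohomologous_equiv : equiv_class_of cohomologous.
Proof.
have cohP F F' : reflect (exists2 a, central_unit a & twist_val F' = twist_val F * delta a)
   (cohomologous F F') := asboolP _.
have sym F F' : cohomologous F F' -> cohomologous F' F.
  move=> /cohP[a ca FF']; apply/cohP; exists a^-1; first exact: central_unitV.
  rewrite (deltaV (central_normalizes ca)) FF' mulrK //.
  by apply: delta_unit; case: ca.
split=> [F|F F'|F' F F''].
- apply/cohP; exists 1; last by rewrite delta1 mulr1.
  exact: central_unit1.
- by apply/idP/idP; apply: sym.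
- move=> /cohP[a ca e] /cohP[b cb e']; apply/cohP; exists (a * b).
    exact: central_unitM.
  by rewrite e' e (deltaM ca.1 (central_normalizes cb)) (mulrA (twist_val F)).
Qed.

Canonical cohomologous_equiv_rel := EquivRelPack cohomologous_equiv.

Definition H2l : Type := {eq_quot cohomologous_equiv_rel}%qT.
HB.instance Definition _ := Choice.on H2l.

Definition H2class (F : inv_twist) : H2l :=
  (\pi_({eq_quot cohomologous_equiv_rel}) F)%qT.

Lemma H2classP F F' : H2class F = H2class F' <->
  exists2 a, central_unit a & twist_val F' = twist_val F * delta a.
Proof.
split=> [/eqmodP/asboolP//|h]; exact/eqmodP/asboolP.
Qed.

Definition H2repr (x : H2l) : inv_twist :=
  generic_quotient.repr (x : {eq_quot cohomologous_equiv_rel}%qT).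

Lemma H2reprK : cancel H2repr H2class.
Proof. exact: reprK. Qed.

Definition H2mul (x y : H2l) := H2class (H2repr x * H2repr y)%g.
Definition H2inv (x : H2l) := H2class (H2repr x)^-1%g.

Lemma H2classM F F' : H2class (F * F')%g = H2mul (H2class F) (H2class F').
Proof.
apply/H2classP.
have /H2classP[a ca e] : H2class F = H2class (H2repr (H2class F)).
  by rewrite H2reprK.
have /H2classP[b cb e'] : H2class F' = H2class (H2repr (H2class F')).
  by rewrite H2reprK.
exists (a * b); first exact: central_unitM.
rewrite /= e e' (deltaM ca.1 (central_normalizes cb)).
have cF' := delta_central ca (twistP F').2.
have reorder (x y z t : galg k (G * G)%type) :
  y * z = z * y -> x * y * (z * t) = x * z * (y * t).
  by move=> yz; rewrite -!mulrA; congr (_ * _); rewrite !mulrA yz.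
exact: reorder.
Qed.

Fact H2mulA : associative H2mul.
Proof.
by move=> x y z; rewrite -(H2reprK x) -(H2reprK y) -(H2reprK z) -!H2classM mulgA.
Qed.
Fact H2mul1l : left_id (H2class 1%g) H2mul.
Proof. by move=> x; rewrite -(H2reprK x) -H2classM mul1g. Qed.
Fact H2mul1r : right_id (H2class 1%g) H2mul.
Proof. by move=> x; rewrite -(H2reprK x) -H2classM mulg1. Qed.
Fact H2mulVl : left_inverse (H2class 1%g) H2inv H2mul.
Proof. by move=> x; rewrite -{2}(H2reprK x) -H2classM mulVg. Qed.
Fact H2mulVr : right_inverse (H2class 1%g) H2inv H2mul.
Proof. by move=> x; rewrite -{1}(H2reprK x) -H2classM mulgV. Qed.

HB.instance Definition _ := isGroup.Build H2l
  H2mulA H2mul1l H2mul1r H2mulVl H2mulVr.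

Definition delta_twist (a : galg k G) (Na : normalizes a) : inv_twist :=
  InvTwist (delta_inv_twist Na).

End Cohomology.

Section IntInn.
Variables (k : fieldType) (G : finGroupType).

Definition implements (a : galg k G) (s : {perm G}) : Prop :=
  forall g, gelt (s g) = a * gelt g * a^-1.

(* Permutations compose from left to right in MathComp; Intk and Inn, being    *)
(* closed under inversion, do not depend on this.                              *)
Definition Intk : {set {perm G}} :=
  [set s in Aut [set: G] | `[< exists2 a, normalizes a & implements a s >]].

Definition Inn : {set {perm G}} := (conj_aut [set: G] @* [set: G])%g.
Canonical Inn_group := [group of Inn].

Lemma IntkP s : reflect (s \in Aut [set: G] /\
  exists2 a, normalizes a & implements a s) (s \in Intk).
Proof.
have -> : (s \in Intk) = (s \in Aut [set: G]) &&
    `[< exists2 a, normalizes a & implements a s >].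
  by rewrite {1}/Intk finset.in_set.
apply: (iffP andP) => [[As /asboolP]|[As sP]] //.
by split=> //; apply/asboolP.
Qed.

Fact Intk_group_set : group_set Intk.
Proof.
apply/group_setP; split=> [|s t].
  apply/IntkP; split; first exact: group1.
  by exists 1; [exact: normalizes1|move=> g; rewrite perm1 invr1 mul1r mulr1].
move=> /IntkP[As [a Na sa]] /IntkP[At [b Nb tb]]; apply/IntkP; split.
  exact: groupM.
exists (b * a); first exact: normalizesM.
by move=> g; rewrite permM tb sa (invrM Nb.1 Na.1) !mulrA.
Qed.
Canonical Intk_group := Group Intk_group_set.

End IntInn.
Arguments Intk k G : clear implicits.

Section Dual.
Variables (k : closedFieldType) (G : finGroupType) (A : {group G}).

(* Hom(A, k^x): as for class functions, a character of A is represented by a   *)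
(* function on G that vanishes outside A.  Its values on A are nonzero since   *)
(* it maps 1 to 1.                                                             *)
Definition is_lchar (chi : {ffun G -> k}) : bool :=
  [&& chi 1%g == 1,
      [forall x in A, forall y in A, chi (x * y)%g == chi x * chi y]
    & [forall (x | x \notin A), chi x == 0]].

Record lchar := LChar { lchar_fun :> {ffun G -> k}; _ : is_lchar lchar_fun }.

HB.instance Definition _ := [isSub for lchar_fun].
HB.instance Definition _ := [Choice of lchar by <:].
Implicit Types (s t : lchar) (x y g : G).

Lemma lchar1 s : s 1%g = 1.
Proof. by case: s => s /= /and3P[/eqP]. Qed.
Lemma lcharM s x y : x \in A -> y \in A -> s (x * y)%g = s x * s y.
Proof.
move=> Ax Ay; case: s => s /= /and3P[_ /forall_inP sM _].
by move/forall_inP: (sM x Ax) => /(_ y Ay)/eqP.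
Qed.
Lemma lchar0 s x : x \notin A -> s x = 0.
Proof. by case: s => s /= /and3P[_ _ /forall_inP s0] /s0/eqP. Qed.
Lemma lcharX s x n : x \in A -> s (x ^+ n)%g = s x ^+ n.
Proof.
move=> Ax; elim: n => [|n IHn]; first by rewrite expg0 lchar1.
by rewrite expgS lcharM ?groupX // IHn exprS.
Qed.

Let rts : seq k := sval (closed_field_poly_normal ('X^#|A| - 1)).

Let lchar_rts s x : x \in A -> s x \in rts.
Proof.
move=> Ax; have p0 : ('X^#|A| - 1 : {poly k}) != 0.
  by rewrite -size_poly_eq0 size_XnsubC.
have : root ('X^#|A| - 1) (s x).
  by apply/rootP; rewrite !hornerE -lcharX // expg_cardG // lchar1 subrr.
rewrite /rts; case: (closed_field_poly_normal _) => r /= {1}->.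
by rewrite rootZ ?lead_coef_eq0 // root_prod_XsubC.
Qed.

Let enc s : {ffun G -> option (seq_sub rts)} := [ffun x => insub (s x)].
Let dec (f : {ffun G -> option (seq_sub rts)}) : option lchar :=
  insub [ffun x => if f x is Some u then val u else 0].
Let encK : pcancel enc dec.
Proof.
move=> s; rewrite /dec; have -> : [ffun x => if enc s x is Some u then val u else 0] = s :> {ffun G -> k}.
  apply/ffunP=> x; rewrite !ffunE; case: insubP => [u _ -> //|].
  by case: (boolP (x \in A)) => [/(lchar_rts s)->//|/lchar0->].
exact: valK.
Qed.
HB.instance Definition _ := PCanIsCountable encK.
HB.instance Definition _ : isFinite lchar := PCanIsFinite encK.

Definition lchar_one_fun : {ffun G -> k} := [ffun x => (x \in A)%:R].
Definition lchar_mul_fun s t : {ffun G -> k} := [ffun x => s x * t x].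
Definition lchar_inv_fun s : {ffun G -> k} := [ffun x => s x^-1%g].
(* The conjugate x |-> s (g x g^-1); as for class functions, g acts trivially  *)
(* when it does not normalize A.                                               *)
Definition lchar_conj_fun s g : {ffun G -> k} :=
  [ffun x => s (if g \in 'N(A)%g then (x ^ g^-1)%g else x)].

Lemma is_lcharP (chi : {ffun G -> k}) :
  chi 1%g = 1 -> {in A &, {morph chi : x y / (x * y)%g >-> x * y}} ->
  (forall x, x \notin A -> chi x = 0) -> is_lchar chi.
Proof.
move=> c1 cM c0; apply/and3P; split; first exact/eqP.
  by apply/forall_inP=> x Ax; apply/forall_inP=> y Ay; rewrite cM.
by apply/forall_inP=> x /c0->.
Qed.

Fact lchar_one_subproof : is_lchar lchar_one_fun.
Proof.
apply: is_lcharP => [|x y Ax Ay|x /negPf Ax]; rewrite !ffunE ?group1 //.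
  by rewrite groupM // Ax Ay mulr1.
by rewrite Ax.
Qed.
Fact lchar_mul_subproof s t : is_lchar (lchar_mul_fun s t).
Proof.
apply: is_lcharP => [|x y Ax Ay|x Ax]; rewrite !ffunE.
- by rewrite !lchar1 mulr1.
- by rewrite !lcharM // mulrACA.
- by rewrite lchar0 // mul0r.
Qed.
Fact lchar_inv_subproof s : is_lchar (lchar_inv_fun s).
Proof.
apply: is_lcharP => [|x y Ax Ay|x Ax]; rewrite !ffunE.
- by rewrite invg1 lchar1.
- by rewrite invMg lcharM ?groupV // mulrC.
- by rewrite lchar0 // groupV.
Qed.
Fact lchar_conj_subproof s g : is_lchar (lchar_conj_fun s g).
Proof.
apply: is_lcharP => [|x y Ax Ay|x Ax]; rewrite !ffunE; case: ifP => Ng.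
- by rewrite conj1g lchar1.
- by rewrite lchar1.
- by rewrite conjMg lcharM // memJ_norm ?groupV.
- by rewrite lcharM.
- by rewrite lchar0 // memJ_norm ?groupV.
- by rewrite lchar0.
Qed.

Definition lchar_one := LChar lchar_one_subproof.
Definition lchar_mul s t := LChar (lchar_mul_subproof s t).
Definition lchar_inv s := LChar (lchar_inv_subproof s).
Definition lchar_conj s g := LChar (lchar_conj_subproof s g).

Fact lchar_mulA : associative lchar_mul.
Proof. by move=> s t u; apply/val_inj/ffunP=> x; rewrite !ffunE mulrA. Qed.
Fact lchar_mul1 : left_id lchar_one lchar_mul.
Proof.
move=> s; apply/val_inj/ffunP=> x; rewrite !ffunE.
by case: (boolP (x \in A)) => [_|/lchar0->]; rewrite ?mul1r ?mulr0.
Qed.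
Fact lchar_mulV : left_inverse lchar_one lchar_inv lchar_mul.
Proof.
move=> s; apply/val_inj/ffunP=> x; rewrite !ffunE.
case: (boolP (x \in A)) => [Ax|/lchar0->]; last by rewrite mulr0.
by rewrite -lcharM ?groupV // mulVg lchar1.
Qed.
HB.instance Definition _ := Finite_isGroup.Build lchar lchar_mulA lchar_mul1 lchar_mulV.

(* The primitive idempotent e_s, characterized by char_ext_idem below. *)
Definition idem s : galg k G := [ffun g => #|A|%:R^-1 * s g^-1%g].

Definition char_ext s (a : galg k G) : k := \sum_(g in A) gcoef a g * s g.

Lemma char_ext_idem (s t : lchar) : #|A|%:R != 0 :> k ->
  char_ext s (idem t) = (s == t)%:R.
Proof.
move=> A0; pose u := (s * t^-1)%g : lchar.
have -> : char_ext s (idem t) = #|A|%:R^-1 * \sum_(g in A) u g.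
  rewrite mulr_sumr; apply: eq_bigr => g _.
  by rewrite /gcoef !ffunE -mulrA [t _ * _]mulrC.
have [st|st] := eqVneq s t.
  rewrite (eq_bigr (fun=> 1)) => [|g Ag]; first by rewrite sumr_const mulVf.
  by rewrite /u st mulgV /= ffunE Ag.
have [h Ah uh] : exists2 h, h \in A & u h != 1.
  apply/exists_inP; apply: contraR st; rewrite negb_exists_in => /forall_inP uA.
  rewrite -(inj_eq (mulIg t^-1%g)) mulgV; apply/eqP/val_inj/ffunP=> x.
  rewrite [RHS]ffunE; case: (boolP (x \in A)) => [Ax|/lchar0->//].
  by have := uA x Ax; rewrite negbK => /eqP.
have : u h * (\sum_(g in A) u g) = \sum_(g in A) u g.
  rewrite mulr_sumr [RHS](reindex_inj (mulgI h)) /=.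
  by apply: eq_big => [g|g Ag]; [rewrite groupMl|exact: esym (lcharM u Ah Ag)].
move/eqP; rewrite -subr_eq0 -{2}[\sum_(g in A) _]mul1r -mulrBl mulf_eq0 subr_eq0.
by rewrite (negPf uh) /= => /eqP->; rewrite mulr0.
Qed.

Definition Rmat (b : lchar -> lchar -> k) : galg k (G * G)%type :=
  \sum_(s : lchar) \sum_(t : lchar) b s t *: tens (idem s) (idem t).

End Dual.

Section Embedding.
Variables (k : fieldType) (G : finGroupType).
Implicit Types (a b z : galg k G) (s t : {perm G}).

Lemma gelt_normalizes x : normalizes (gelt x : galg k G).
Proof.
have [ux _] := geltV k x; apply: normalizes_of => // g.
  by exists (g ^ x)%g; rewrite -!geltM -conjgC.
by exists (g ^ x^-1)%g; rewrite -!geltM conjgE invgK -!mulgA mulVg mulg1.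
Qed.

Lemma delta_gelt x : delta (gelt x : galg k G) = 1.
Proof.
have [_ xV] := geltV k x; rewrite /delta xV tens_gelt coprod_gelt -geltM.
by rewrite -gelt1; congr gelt; congr (_, _); apply: mulgV.
Qed.

Lemma delta_eq1 a : a \is a GRing.unit -> delta a = 1 -> exists x, a = gelt x.
Proof.
move=> ua d1; have aa : tens a a = coprod a.
  rewrite -[RHS]mul1r -d1 /delta -mulrA -coprodM mulVr //.
  by rewrite [coprod 1]gext1 // mulr1.
have c g h : gcoef a g * gcoef a h = (g == h)%:R * gcoef a g.
  have := congr1 (fun u => gcoef u (g, h)) aa; rewrite gcoef_tens /= => ->.
  rewrite /coprod /gext gcoef_sum (bigD1 g) //= big1 ?addr0.
    by rewrite gcoefZ gcoef_gelt -pair_eqE /= eqxx /= eq_sym mulrC.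
  move=> x xg; rewrite gcoefZ gcoef_gelt -pair_eqE /=.
  by rewrite eq_sym (negPf xg) mulr0.
have [x ax] : exists x, gcoef a x != 0.
  apply/existsP; apply: contraLR ua; rewrite negb_exists => /forallP a0.
  have -> : a = 0.
    apply: galgP => g; have := a0 g; rewrite negbK => /eqP->.
    by rewrite /gcoef ffunE.
  by rewrite unitr0.
exists x; apply: galgP => g; rewrite gcoef_gelt.
have [->|xg] := eqVneq g x.
  by apply: (mulfI ax); rewrite c eqxx mul1r mulr1.
by apply: (mulfI ax); rewrite c eq_sym (negPf xg) mul0r mulr0.
Qed.

Lemma implementsM a b s t :
  a \is a GRing.unit -> b \is a GRing.unit ->
  implements a s -> implements b t -> implements (b * a) (s * t)%g.
Proof. by move=> ua ub sa tb g; rewrite permM tb sa invrM // !mulrA. Qed.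

Lemma conj_aut_implements x : implements (gelt x^-1%g : galg k G) (conj_aut [set: G] x).
Proof.
move=> g; rewrite conj_autE ?finset.in_setT //.
have [_ ->] := geltV k x^-1%g.
by rewrite invgK -!geltM conjgE mulgA.
Qed.

Lemma implements_inj a s t : implements a s -> implements a t -> s = t.
Proof.
move=> sa ta; apply/permP => g.
by apply: (@gelt_inj k); rewrite sa ta.
Qed.

Lemma InnP s : reflect (exists x, s = conj_aut [set: G] x) (s \in Inn G).
Proof.
apply: (iffP morphimP) => [[x _ _ ->]|[x ->]]; first by exists x.
have Tx : x \in [set: G] by rewrite finset.in_setT.
have Nx : x \in 'N([set: G])%g by apply: (fintype.subsetP (normG _)).
by exists x.
Qed.

Lemma class_delta a b (Na : normalizes a) (Nb : normalizes b) s t :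
  implements a s -> implements b t ->
  H2class (delta_twist (normalizesV Na)) =
    H2class (delta_twist (normalizesV Nb)) <-> (s * t^-1)%g \in Inn G.
Proof.
move=> sa tb; have [ua ub] := (Na.1, Nb.1); split.
  move=> /H2classP[z cz /= dE]; have uz := cz.1.
  have zN := central_normalizes cz.
  have [] := @delta_eq1 (b^-1 * (a * z^-1)).
  - by rewrite (unitrMr (a * _)) ?unitrV // (unitrMr _ ua) unitrV.
  - rewrite deltaM ?unitrV //; last exact/normalizesM/normalizesV.
    rewrite dE (deltaM ua (normalizesV zN)) (deltaV Na) (deltaV zN).
    have ci : delta z * (delta a * (delta z)^-1) = delta a.
      rewrite mulrA (delta_central cz (delta_invariant Na)) -mulrA divrr ?mulr1 //.
      exact: delta_unit.
    by rewrite -mulrA ci mulVr // delta_unit.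
  move=> x xE; have aE : a = b * gelt x * z.
    by rewrite -xE mulVKr // mulrVK.
  have -> : s = (conj_aut [set: G] x^-1 * t)%g.
    have [ux _] := geltV k x.
    have tc : implements (b * gelt x) (conj_aut [set: G] x^-1 * t)%g.
      apply: implementsM => //; have := conj_aut_implements x^-1.
      by rewrite invgK.
    apply/permP => g; apply: (@gelt_inj k); rewrite sa tc aE.
    move: (b * gelt x) (unitrMr (gelt x) ub) => c; rewrite ux => uc.
    by rewrite (invrM uc uz) !mulrA -(mulrA c z) cz.2 mulrA (mulrK uz).
  by rewrite mulgK; apply/InnP; exists x^-1%g.
move=> /InnP[x stx]; have sE : s = (conj_aut [set: G] x * t)%g by rewrite -stx mulgVK.
have [ux xV] := geltV k x.
have tc : implements (b * gelt x^-1%g) s.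
  rewrite sE; apply: implementsM => //; first by have [] := geltV k x^-1%g.
  exact: conj_aut_implements.
have cz : central_unit (gelt x * b^-1 * a).
  split; first by rewrite !unitrMr ?unitrV.
  move=> c; rewrite (galgE c) mulr_sumr mulr_suml; apply: eq_bigr => g _.
  rewrite -scalerAl -scalerAr; congr (_ *: _).
  have : a * gelt g * a^-1 = b * gelt x^-1%g * gelt g * (b * gelt x^-1%g)^-1.
    by rewrite -sa tc.
  rewrite -xV invrM ?unitrV // invrK => /(congr1 (fun u => gelt x * (b^-1 * (u * a)))).
  rewrite mulrVK // -!mulrA (mulKr ub) (mulVKr ux).
  by rewrite !mulrA.
have : b^-1 = gelt x^-1%g * ((gelt x * b^-1 * a) * a^-1).
  by rewrite mulrK // -xV mulKr.
move: (gelt x * b^-1 * a) cz => z cz bE.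
have aN := normalizesV Na; have zN := central_normalizes cz.
apply/H2classP; exists z => //=; rewrite {1}bE.
have [ux' _] := geltV k x^-1%g.
rewrite (deltaM ux' (normalizesM zN aN)) delta_gelt mul1r (deltaM cz.1 aN).
exact: delta_central cz (delta_invariant aN).
Qed.

End Embedding.

Section IntInnH2.
Variables (k : fieldType) (G : finGroupType).

(* The image of N_k(G) in H^2.  By Intk_Inn_embedding below it is the image of *)
(* an embedding of Int_k(G) / Inn(G).  The inverse in that lemma comes from    *)
(* the order of composition in {perm G}.                                       *)
Definition IntInn_H2 : set (H2l k G) :=
  [set x | exists a (Na : normalizes a), x = H2class (delta_twist Na)]%classic.

Lemma Inn_sub_Intk : Inn G \subset Intk k G.
Proof.
apply/fintype.subsetP => _ /InnP[x ->]; apply/IntkP; split.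
  have /fintype.subsetP := Aut_conj_aut [set: G] [set: G]; apply.
  by apply/InnP; exists x.
by exists (gelt x^-1%g); [exact: gelt_normalizes|exact: conj_aut_implements].
Qed.

Lemma Inn_normal_Intk : (Inn G <| Intk k G)%g.
Proof.
apply/andP; split; first exact: Inn_sub_Intk.
apply/fintype.subsetP => s /IntkP[_ [a Na sa]]; rewrite finset.inE.
apply/fintype.subsetP => t /imsetP[_ /InnP[x ->] ->].
have ua := Na.1; apply/InnP; exists (s x); apply/permP => g.
rewrite /conjg !permM; apply: (@gelt_inj k).
rewrite sa !conj_autE ?finset.in_setT // !conjgE !geltM !sa.
have [uy yV] := geltV k x; have [_ syV] := geltV k (s x).
have gE : gelt g = a * gelt (s^-1%g g) * a^-1 :> galg k G by rewrite -sa permKV.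
rewrite gE -syV sa -yV !(invrM, unitrMr _ ua, unitrV) // invrK.
by rewrite !mulrA !(mulrVK ua).
Qed.

Lemma Intk_Inn_embedding :
  exists f : coset_of (Inn G) -> H2l k G,
    [/\ {in (Intk k G / Inn G)%g &, {morph f : x y / (x * y)%g}},
        {in (Intk k G / Inn G)%g &, injective f},
        (f @` [set` (Intk k G / Inn G)%g] = IntInn_H2)%classic
      & forall a (Na : normalizes a) s, implements a s ->
          f (coset (Inn G) s) = (H2class (delta_twist Na))^-1%g].
Proof.
pose N a := normalizes (a : galg k G).
pose P (C : coset_of (Inn G)) (y : H2l k G) := exists s a (Na : N a),
  [/\ implements a s, coset (Inn G) s = C & y = H2class (delta_twist (normalizesV Na))].
have IntN s : s \in Intk k G -> s \in 'N(Inn G)%g.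
  by apply/fintype.subsetP; case/andP: Inn_normal_Intk.
have impInt s a : N a -> implements a s -> s \in Intk k G.
  move=> Na sa; apply/IntkP; split; last by exists a.
  rewrite inE; apply/andP; split; first by apply/fintype.subsetP => g; rewrite finset.in_setT.
  apply/morphicP => x y _ _; apply: (@gelt_inj k).
  by rewrite sa !geltM !sa !mulrA (mulrVK Na.1).
have Puniq C y y' : P C y -> P C y' -> y = y'.
  move=> [s [a [Na [sa sC ->]]]] [t [b [Nb [tb tC ->]]]].
  apply/(class_delta Na Nb sa tb); rewrite -mem_rcoset.
  apply/rcoset_kercosetP; [exact: IntN (impInt _ _ Na sa)|exact: IntN (impInt _ _ Nb tb)|].
  by rewrite sC tC.
have Pex C : C \in (Intk k G / Inn G)%g -> exists y, P C y.
  move=> /morphimP[s _ /IntkP[_ [a Na sa]] ->].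
  by exists (H2class (delta_twist (normalizesV Na))), s, a, Na.
pose f C := xget 1%g (P C).
have fP C : C \in (Intk k G / Inn G)%g -> P C (f C).
  by move=> /Pex; apply: xgetPex.
have fE C y : P C y -> f C = y.
  by move=> PCy; apply: (Puniq C _ _ (xgetI _ PCy) PCy).
have Vclass a (Na : N a) :
    H2class (delta_twist (normalizesV Na)) = (H2class (delta_twist Na))^-1%g.
  apply: (mulgI (H2class (delta_twist Na))); rewrite mulgV -[LHS]H2classM.
  congr H2class; apply: twist_val_inj; rewrite /= (deltaV Na) divrr //.
  exact: delta_unit Na.1.
exists f; split.
- move=> C D /fP[s [a [Na [sa sC fC]]]] /fP[t [b [Nb [tb tD fD]]]].
  apply: fE; exists (s * t)%g, (b * a), (normalizesM Nb Na); split.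
  + exact: implementsM Na.1 Nb.1 sa tb.
  + rewrite -sC -tD coset_morphM //; apply: IntN.
      exact: impInt Na sa.
    exact: impInt Nb tb.
  + rewrite fC fD -[LHS]H2classM; congr H2class; apply: twist_val_inj => /=.
    rewrite -(deltaM _ (normalizesV Nb)) ?unitrV ?Na.1 //; congr delta.
    by rewrite (invrM Nb.1 Na.1).
- move=> C D /fP[s [a [Na [sa sC fC]]]] /fP[t [b [Nb [tb tD fD]]]] CD.
  rewrite -sC -tD; apply/rcoset_kercosetP; [exact: IntN (impInt _ _ Na sa)|exact: IntN (impInt _ _ Nb tb)|].
  by rewrite mem_rcoset; apply/(class_delta Na Nb sa tb); rewrite -fC -fD.
- apply/seteqP; split=> [_ [C /= /fP[s [a [Na [_ _ ->]]]] <-]|x [a [Na ->]]].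
    by exists a^-1, (normalizesV Na).
  have [aG Ga] := normalizesP Na.
  pose h g := projT1 (cid (aG g)).
  have hE g : gelt g * a = a * gelt (h g) by rewrite /h; case: cid.
  have hI : injective h.
    move=> g g' hh; apply: (@gelt_inj k); apply: (mulIr Na.1).
    by rewrite !hE hh.
  have sV : implements a^-1 (perm hI).
    move=> g; rewrite permE invrK; apply: (mulrI Na.1).
    by rewrite -hE -mulrA mulVKr // Na.1.
  exists (coset (Inn G) (perm hI)).
    by rewrite /= mem_quotient //; apply: impInt sV; apply: normalizesV.
  rewrite (fE _ (H2class (delta_twist (normalizesV (normalizesV Na))))).
    by congr H2class; apply: twist_val_inj; rewrite /= invrK.
  by exists (perm hI), a^-1, (normalizesV Na).
- by move=> a Na s sa; rewrite -Vclass; apply: fE; exists s, a, Na.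
Qed.

End IntInnH2.

Section Pairs.
Variables (k : closedFieldType) (G : finGroupType).

(* form_neq0 says that b takes its values in k^x. *)
Record is_inv_alt_form (A : {group G}) (b : lchar k A -> lchar k A -> k) : Prop := {
  form_neq0 : forall s t, b s t != 0;
  form_bilinear_l : forall s s' t, b (s * s')%g t = b s t * b s' t;
  form_bilinear_r : forall s t t', b s (t * t')%g = b s t * b s t';
  form_alternating : forall s, b s s = 1;
  form_nondegenerate_l : forall s, (forall t, b s t = 1) -> s = 1%g;
  form_nondegenerate_r : forall t, (forall s, b s t = 1) -> t = 1%g;
  form_invariant : forall g s t, b (lchar_conj s g) (lchar_conj t g) = b s t
}.

Record form_pair := FormPair {
  fp_group : {group G};
  fp_form : lchar k fp_group -> lchar k fp_group -> k;
  fp_abelian : abelian fp_group;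
  fp_normal : (fp_group <| [set: G])%g;
  fp_formP : is_inv_alt_form fp_form
}.

HB.instance Definition _ := gen_eqMixin form_pair.
HB.instance Definition _ := gen_choiceMixin form_pair.

Fact lchar_trivial (s : lchar k (1%G : {group G})) : s = 1%g.
Proof.
apply/val_inj/ffunP=> x; rewrite [RHS]ffunE.
case: (boolP (x \in 1%G)) => [/set1P->|/lchar0->//]; exact: lchar1.
Qed.

Fact trivial_formP : @is_inv_alt_form 1%G (fun _ _ => 1).
Proof.
by split=> *; rewrite ?oner_eq0 ?mulr1 //; apply: lchar_trivial.
Qed.

Definition form_pair1 : form_pair :=
  FormPair (abelian1 G) (normal1 [set: G]) trivial_formP.

End Pairs.

Section Theta.
Variables (k : closedFieldType) (G : finGroupType).
Implicit Types (U H : {vspace galg k G}).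

Definition tensv U H : {vspace galg k (G * G)%type} :=
  <<[seq tens u v | u <- vbasis U, v <- vbasis H]>>%VS.

Definition hopf_subalgebra H : Prop :=
  [/\ 1 \in H,
      forall a b, a \in H -> b \in H -> a * b \in H,
      forall a, a \in H -> coprod a \in tensv H H
    & forall a, a \in H -> antipode a \in H].

Definition subgroup_algebra (A : {group G}) : {vspace galg k G} :=
  <<[seq gelt a | a <- enum A]>>%VS.

Definition Rtwist (F : galg k (G * G)%type) : galg k (G * G)%type :=
  flip F * F^-1.

Definition is_Theta (F : inv_twist k G) (p : form_pair k G) : Prop :=
  let kA := subgroup_algebra (fp_group p) in
  [/\ hopf_subalgebra kA,
      Rtwist F \in tensv kA kA,
      forall H, hopf_subalgebra H -> Rtwist F \in tensv H H -> (kA <= H)%VS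
    & Rtwist F = Rmat (@fp_form _ _ p)].

(* A choice among the pairs satisfying is_Theta: that exactly one exists is a  *)
(* theorem, not proved here, so the default value is immaterial.               *)
Definition Theta_twist (F : inv_twist k G) : form_pair k G :=
  xget (form_pair1 k G) (is_Theta F).

Definition Theta (x : H2l k G) : form_pair k G := Theta_twist (H2repr x).

Definition supported (F : inv_twist k G) (A : {group G}) : Prop :=
  fp_group (Theta_twist F) = A /\
  twist_val F \in tensv (subgroup_algebra A) (subgroup_algebra A).

Let flipM : {morph (fun p : G * G => (p.2, p.1)) : x y / (x * y)%g}.
Proof. by []. Qed.

Lemma flip_delta a : flip (delta a) = delta a :> galg k (G * G)%type.
Proof.
rewrite /delta /flip (gextM flipM) [X in _ * X]gext_comp -/(coprod _).
congr (_ * _); rewrite tensE linear_sum [RHS]exchange_big /=; apply: eq_bigr => g _.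
rewrite linear_sum /=; apply: eq_bigr => h _.
by rewrite linearZ /= gext_gelt mulrC.
Qed.

Lemma Theta_class F : Theta (H2class F) = Theta_twist F.
Proof.
rewrite /Theta /Theta_twist; congr xget.
have [a ca e] : exists2 a, central_unit a &
    twist_val (H2repr (H2class F)) = twist_val F * delta a.
  by apply/H2classP; rewrite H2reprK.
have RE : Rtwist (H2repr (H2class F)) = Rtwist F.
  have ud := delta_unit ca.1.
  have uF : twist_val F \is a GRing.unit by case: (twistP F) => [[]].
  rewrite /Rtwist e (invrM uF ud) {1}/flip (gextM flipM) -!/(flip _) flip_delta.
  by rewrite -mulrA (mulVKr ud).
by rewrite /is_Theta RE.
Qed.

End Theta.

(* Main.v *)
Require Import Defs.
From HB Require Import structures.
From mathcomp Require Import all_boot all_order all_fingroup all_algebra cyclic falgebra.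
From mathcomp Require Import ring.
From mathcomp Require Import boolp classical_sets.

Set Implicit Arguments.
Unset Strict Implicit.
Unset Printing Implicit Defensive.

Import GRing.Theory.
Local Open Scope ring_scope.

(** The R-matrix R = F_21 F^-1 of an invariant twist satisfies the hexagon
    identity (Delta (x) id)(R) = R_13 R_23 and R_21 = R^-1.  On coefficients,
    R = sum_g g (x) r_g where the r_g are orthogonal idempotents with sum 1;
    those that are nonzero span k[A] for an abelian normal subgroup A, and
    b(s, t) = (s (x) t)(R) is a bicharacter of the dual of A with b(s, s) = 1
    or -1.  The functional T(X) = sum_g X(g, g^-1) satisfies T(X_21 Y) = T(Y X),
    so T(R) = 1, that is, the mean of the b(s, s) is 1, and b is alternating.
    Hence Theta F = Theta F' if and only if R_F = R_F', i.e. J = F^-1 F' is a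
    symmetric invariant twist.  For such a J, the operators
    x |-> (f (x) id)(Delta(x) J) on k[G] commute; a common eigenvector,
    rescaled, satisfies Delta(a) J = a (x) a, is invertible and normalizes G,
    so that J = (a (x) a) Delta(a^-1).  If |A| = 2 m + 1, then b^m is an
    invariant bicharacter, hence a twist, with R-matrix b^(-2m) = b. *)

(** * Commuting operators *)

Section CommonEigenvector.
Variables (K : closedFieldType) (vT : vectType K).
Implicit Types (f : 'End(vT)) (U : {vspace vT}) (v : vT).

(** Row i of [B] holds the coordinates of the image of the i-th basis vector of U, so a left
    eigenvector of [B] lists the coordinates of an eigenvector of f. *)
Lemma eigenvector_in_stable f U : U != 0%VS -> (f @: U <= U)%VS ->
  exists v c, [/\ v \in U, v != 0 & f v = c *: v].
Proof.
move=> U0 fU; pose n := \dim U; pose b := vbasis U.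
have bU i : b`_i \in U.
  have [ltin|] := ltnP i n; first by rewrite (vbasis_mem (mem_nth _ _)) ?size_tuple.
  by move=> leni; rewrite nth_default ?size_tuple ?mem0v.
have fb i : f b`_i = \sum_(j < n) coord b j (f b`_i) *: b`_j.
  by apply: coord_vbasis; apply: (subvP fU); apply: memv_img.
pose B : 'M[K]_n := \matrix_(i, j) coord b j (f b`_i).
have n0 : (0 < n)%N by rewrite lt0n dimv_eq0.
have [c rc] : exists c, root (char_poly B) c.
  by apply/closed_rootP; rewrite size_char_poly eqSS -lt0n.
have /eigenvalueP[w wB w0] : eigenvalue B c by rewrite eigenvalue_root_char.
pose v := \sum_(i < n) w 0 i *: b`_i.
have vcoord i : coord b i v = w 0 i.
  by rewrite coord_sum_free // (basis_free (vbasisP U)).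
exists v, c; split.
- by apply: memv_suml => i _; apply: memvZ.
- apply: contra w0 => /eqP v0; apply/eqP/rowP => i.
  by rewrite -vcoord v0 linear0 mxE.
- rewrite linear_sum /= scaler_sumr.
  under eq_bigr => i _ do rewrite linearZ /= fb scaler_sumr.
  rewrite exchange_big /=; apply: eq_bigr => j _.
  have /rowP/(_ j) := wB; rewrite !mxE => wj.
  rewrite scalerA -wj scaler_suml; apply: eq_bigr => i _.
  by rewrite scalerA mxE.
Qed.

(** Induction on the dimension of U: if some [f i] is not a scalar on U, one of its eigenspaces in U
    is nonzero, proper, and stable under all the other operators because they commute with [f i]. *)
Lemma common_eigenvector (I : Type) (f : I -> 'End(vT)) U :
  (forall i j v, f i (f j v) = f j (f i v)) -> (forall i, (f i @: U <= U)%VS) ->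
  U != 0%VS ->
  exists v, [/\ v \in U, v != 0 & forall i, exists c, f i v = c *: v].
Proof.
move=> fC; have [n] := ubnP (\dim U); elim: n U => // n IHn U ltUn fU U0.
have [scal|] := pselect (forall i, exists c, forall v, v \in U -> f i v = c *: v).
  exists (vpick U); split; [exact: memv_pick|by rewrite vpick0|move=> i].
  by have [c fc] := scal i; exists c; rewrite fc ?memv_pick.
move=> /existsNP[i iN].
have [v [c [vU v0 fv]]] := eigenvector_in_stable U0 (fU i).
pose W := (U :&: lker (f i - c *: \1)%VF)%VS.
have inW x : (x \in W) = (x \in U) && (f i x == c *: x).
  by rewrite memv_cap memv_ker lfunE /= lfunE /= lfunE /= id_lfunE subr_eq0.
have WU : (W <= U)%VS by apply: capvSl.
have [|||x [xW x0 xP]] := IHn W.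
- rewrite ltnS in ltUn; apply: leq_trans ltUn; rewrite ltn_neqAle dimvS // andbT.
  apply: contra_notN iN => /eqP dW; exists c => x.
  have /eqP <- : W == U by rewrite eqEdim WU dW /=.
  by rewrite inW => /andP[_ /eqP].
- move=> j; apply/subvP => _ /memv_imgP[x xW ->].
  move: xW; rewrite !inW => /andP[xU /eqP fx].
  by rewrite (subvP (fU j)) ?memv_img //= fC fx linearZ.
- by apply/eqP => W0; have : v \in W; [rewrite inW vU fv eqxx|rewrite W0 memv0 (negPf v0)].
- by exists x; split=> //; apply: (subvP WU).
Qed.

End CommonEigenvector.

(** * Characters of a finite abelian group *)

Section CharacterTheory.
Variables (k : closedFieldType) (G : finGroupType) (A : {group G}).
Hypotheses (char0 : [pchar k] =i pred0) (abA : abelian A).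
Implicit Types (s t : lchar k A) (a g h x : G).

Lemma natr_neq0 n : (0 < n)%N -> n%:R != 0 :> k.
Proof. by rewrite lt0n ((pcharf0P k).1 char0). Qed.

Let A0 : #|A|%:R != 0 :> k. Proof. exact: natr_neq0 (cardG_gt0 A). Qed.

Lemma lchar_mulE s t g : (s * t)%g g = s g * t g.
Proof. by rewrite /= ffunE. Qed.

Lemma lchar_invE s g : s^-1%g g = s g^-1%g.
Proof. by rewrite /= ffunE. Qed.

Lemma lchar_1E g : (1%g : lchar k A) g = (g \in A)%:R.
Proof. by rewrite /= ffunE. Qed.

Lemma lchar_eqP s t : {in A, s =1 t} -> s = t.
Proof.
move=> st; apply/val_inj/ffunP => g.
by case: (boolP (g \in A)) => [/st|gA]; rewrite // !lchar0.
Qed.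

(** A acts by left multiplication on the right ideal (h - 1) k[G], which is nonzero. The eigenvalues
    of A on a common eigenvector form the required character. *)
Lemma exists_lchar_neq1 h : h \in A -> h != 1%g -> exists s, s h != 1.
Proof.
move=> hA h1; pose f (a : {a | a \in A}) := amull (gelt (val a) : galg k G).
have fE (a : {a | a \in A}) (x : galg k G) : f a x = gelt (val a) * x by rewrite lfunE.
have fC (a b : {a | a \in A}) :
    gelt (val a) * gelt (val b) = gelt (val b) * gelt (val a) :> galg k G.
  by rewrite -!geltM (centsP abA _ (valP a) _ (valP b)).
pose W := limg (amull (gelt h - 1 : galg k G)).
have [|||v [/memv_imgP[w _ vE] v0 vP]] := @common_eigenvector k (galg k G) _ f W.
- by move=> a b x; rewrite !fE !mulrA fC.
- move=> a; apply/subvP => _ /memv_imgP[_ /memv_imgP[x _ ->] ->].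
  rewrite fE lfunE /= mulrA mulrBr mulr1 (fC a (exist _ h hA)) -[X in _ - X]mul1r.
  rewrite -mulrBl -mulrA; have -> : (gelt h - 1) * (gelt (val a) * x) =
    amull (gelt h - 1) (gelt (val a) * x) by rewrite lfunE.
  by rewrite memv_img ?memvf.
- apply: contra h1 => /eqP W0; have : amull (gelt h - 1) 1 \in W by rewrite memv_img ?memvf.
  rewrite W0 memv0 lfunE /= mulr1 subr_eq0 -gelt1 => /eqP/gelt_inj->.
  exact: eqxx.
have {}vE : v = (gelt h - 1 : galg k G) * w by rewrite vE lfunE.
have {vP} [c cP] : exists c : G -> k, forall a, a \in A -> gelt a * v = c a *: v.
  have cP a : exists x : k, a \in A -> gelt a * v = x *: v.
    case: (boolP (a \in A)) => [aA|_]; last by exists 0.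
    by have [x] := vP (exist _ a aA); rewrite fE; exists x.
  by exists (fun a => projT1 (cid (cP a))) => a; case: cid.
have vI (x y : k) : x *: v = y *: v -> x = y.
  move/eqP; rewrite -subr_eq0 -scalerBl scaler_eq0 (negPf v0) orbF subr_eq0.
  by move/eqP.
pose s0 : {ffun G -> k} := [ffun a => if a \in A then c a else 0].
have sP : is_lchar A s0.
  apply: is_lcharP => [|a b aA bA|a /negPf aA]; rewrite !ffunE ?group1 ?groupM ?aA ?bA //.
    by apply: vI; rewrite -cP // gelt1 mul1r scale1r.
  by apply: vI; rewrite -cP ?groupM // geltM -mulrA cP // -scalerAr cP // scalerA mulrC.
exists (LChar sP); rewrite /= ffunE hA; apply: contra v0 => /eqP ch1.
have hv i : gelt (h ^+ i)%g * v = v.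
  by elim: i => [|i IHi]; rewrite ?gelt1 ?mul1r // expgSr geltM -mulrA cP // ch1 scale1r.
(* If the character were 1 at h, every power of h would fix v. As v = (h - 1) w, the sum of the h^i
   v telescopes to 0, which contradicts characteristic zero. *)
have : \sum_(i < #[h]%g) gelt (h ^+ i)%g * v = #[h]%g%:R *: v.
  by rewrite (eq_bigr (fun=> v)) // sumr_const card_ord scaler_nat.
rewrite -mulr_suml vE mulrA [X in X * w](_ : _ = 0) ?mul0r.
  by move/esym/eqP; rewrite scaler_eq0 (negPf (natr_neq0 (order_gt0 h))).
rewrite mulrBr mulr1 mulr_suml; case: #[h]%g (expg_order h) (order_gt0 h) => // n hn _.
under eq_bigr do rewrite -geltM -expgSr.
by rewrite big_ord_recr [X in _ - X]big_ord_recl /= hn expg0 [X in X - _]addrC subrr.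
Qed.

Lemma sum_lchar s : \sum_(g in A) s g = #|A|%:R * (s == 1%g)%:R.
Proof.
rewrite -(char_ext_idem s 1%g A0) mulr_sumr; apply: eq_bigr => g gA.
by rewrite /gcoef ffunE lchar_1E groupV gA mulr1 mulVKf.
Qed.

Let sum_lchar_dual_card g : g \in A ->
  \sum_(s : lchar k A) s g = #|[set: lchar k A]|%:R * (g == 1%g)%:R :> k.
Proof.
move=> gA; have [->|g1] := eqVneq g 1%g.
  by rewrite mulr1 (eq_bigr (fun=> 1)) ?sumr_const ?cardsT // => s; rewrite lchar1.
have [t tg] := exists_lchar_neq1 gA g1.
have : t g * (\sum_(s : lchar k A) s g) = \sum_(s : lchar k A) s g.
  rewrite mulr_sumr [RHS](reindex_inj (mulgI t)) /=.
  by apply: eq_bigr => s _; rewrite ffunE.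
move/eqP; rewrite -subr_eq0 -{2}[\sum_(s : lchar k A) _]mul1r -mulrBl mulf_eq0 subr_eq0.
by rewrite (negPf tg) mulr0 => /eqP.
Qed.

(** Double counting of the sum of all values s g, using orthogonality over the dual for one order of
    summation and over A for the other. *)
Lemma card_lchar : #|[set: lchar k A]|%:R = #|A|%:R :> k.
Proof.
have : \sum_(g in A) \sum_(s : lchar k A) s g =
    \sum_(s : lchar k A) \sum_(g in A) s g :> k by rewrite exchange_big.
rewrite (eq_bigr (fun g => #|[set: lchar k A]|%:R * (g == 1%g)%:R)) => [|g]; last first.
  exact: sum_lchar_dual_card.
rewrite (bigD1 1%g) //= big1 ?addr0 => [|g /andP[_ /negPf->]]; last by rewrite mulr0.
rewrite eqxx mulr1 => ->; under eq_bigr do rewrite sum_lchar.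
rewrite (bigD1 1%g) //= big1 ?addr0 => [|g /negPf->]; last by rewrite mulr0.
by rewrite eqxx mulr1.
Qed.

Lemma sum_lchar_dual g : g \in A -> \sum_(s : lchar k A) s g = #|A|%:R * (g == 1%g)%:R :> k.
Proof. by move=> gA; rewrite sum_lchar_dual_card // card_lchar. Qed.

Lemma sum_lchar_mulV g h :
  \sum_(s : lchar k A) s g * s h^-1%g = #|A|%:R * ((g == h) && (g \in A))%:R :> k.
Proof.
have [gA|gA] := boolP (g \in A); last first.
  by rewrite andbF mulr0 big1 // => s _; rewrite lchar0 ?mul0r.
have [hA|hA] := boolP (h \in A); last first.
  have [gh|_] := eqVneq g h; first by rewrite -gh gA in hA.
  by rewrite /= mulr0 big1 // => s _; rewrite [s h^-1%g]lchar0 ?mulr0 // groupV.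
under eq_bigr do rewrite -lcharM ?groupV //.
by rewrite sum_lchar_dual ?groupM ?groupV // -eq_mulgV1 andbT.
Qed.

Lemma gcoef_idem s g : gcoef (idem s) g = #|A|%:R^-1 * s g^-1%g.
Proof. by rewrite /gcoef ffunE. Qed.

Lemma gelt_idem a s : a \in A -> gelt a * idem s = s a *: idem s.
Proof.
move=> aA; apply: galgP => g; rewrite gcoefZ gcoef_mul (bigD1 a) //= big1.
  rewrite addr0 gcoef_gelt eqxx mul1r !gcoef_idem mulrCA; congr (_ * _).
  have [gA|gA] := boolP (g \in A); last first.
    by rewrite [s g^-1%g]lchar0 ?groupV // [s _]lchar0 ?mulr0 // groupV groupMl ?groupV.
  by rewrite invMg invgK lcharM ?groupV // mulrC.
by move=> x /negPf xa; rewrite gcoef_gelt xa mul0r.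
Qed.

Lemma idemE s : idem s = \sum_(g in A) (#|A|%:R^-1 * s g^-1%g) *: gelt g.
Proof.
rewrite [LHS]galgE [RHS]big_mkcond; apply: eq_bigr => g _; rewrite gcoef_idem.
by case: ifP => // /negbT gA; rewrite lchar0 ?groupV // mulr0 scale0r.
Qed.

Lemma idemM s t : idem s * idem t = (s == t)%:R *: idem t.
Proof.
rewrite eq_sym -(char_ext_idem t s A0) {1}idemE mulr_suml scaler_suml.
by apply: eq_bigr => g gA; rewrite -scalerAl gelt_idem // scalerA gcoef_idem.
Qed.

Lemma sum_idem : \sum_(s : lchar k A) idem s = 1 :> galg k G.
Proof.
apply: galgP => g; rewrite gcoef_sum -gelt1 gcoef_gelt.
rewrite (eq_bigr (fun s => #|A|%:R^-1 * (s 1%g * s g^-1%g))) => [|s _]; last first.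
  by rewrite gcoef_idem lchar1 mul1r.
by rewrite -mulr_sumr sum_lchar_mulV group1 andbT mulKf // eq_sym.
Qed.

Lemma gelt_sum_idem a : a \in A -> gelt a = \sum_(s : lchar k A) s a *: idem s.
Proof.
move=> aA; rewrite -[LHS]mulr1 -sum_idem mulr_sumr.
by apply: eq_bigr => s _; rewrite gelt_idem.
Qed.

Lemma idem_conj s x : (A <| [set: G])%g ->
  gelt x * idem s = idem (lchar_conj s x^-1%g) * gelt x.
Proof.
move=> nA; have NA y : y \in 'N(A)%g.
  by apply: (fintype.subsetP (normal_norm nA)); rewrite finset.in_setT.
apply: galgP => g; rewrite !gcoef_mul (bigD1 x) //= [RHS](bigD1 (g * x^-1)%g) //=.
rewrite !big1 ?addr0 => [|y yg|y /negPf yx]; last by rewrite gcoef_gelt yx mul0r.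
  rewrite !gcoef_gelt eqxx mul1r !gcoef_idem !invMg !invgK mulgVK eqxx mulr1.
  by rewrite /= ffunE NA invgK conjgE -mulgA mulKg.
rewrite [X in _ * X]gcoef_gelt; case: eqP => [yx|]; last by rewrite mulr0.
by case/eqP: yg; rewrite -yx invMg invgK mulKVg.
Qed.

End CharacterTheory.

(** * Hopf subalgebras supporting R(A, b) *)

Section TensorSubspaces.
Variables (k : closedFieldType) (G : finGroupType).
Implicit Types (U H : {vspace galg k G}) (A : {group G}) (f : G -> k).

Lemma mem_tensv U H u v : u \in U -> v \in H -> tens u v \in tensv U H.
Proof.
move=> uU vH; rewrite (coord_vbasis uU) (coord_vbasis vH).
have t0r (a : galg k G) : tens a 0 = 0 by rewrite -[X in tens _ X](scale0r 0) tensZr scale0r.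
have t0l (a : galg k G) : tens 0 a = 0 by rewrite -[X in tens X _](scale0r 0) tensZl scale0r.
have sumr (a : galg k G) (I : finType) (F : I -> galg k G) :
    tens a (\sum_i F i) = \sum_i tens a (F i).
  exact: (big_morph _ (tensDr a) (t0r a)).
have suml (a : galg k G) (I : finType) (F : I -> galg k G) :
    tens (\sum_i F i) a = \sum_i tens (F i) a.
  exact: (big_morph _ (fun x y => tensDl x y a) (t0l a)).
rewrite suml memv_suml // => i _; rewrite sumr memv_suml // => j _.
rewrite tensZl tensZr !memvZ // memv_span //; apply: allpairs_f;
  by rewrite mem_nth // size_tuple.
Qed.

(** This is (f (x) id)(X), with f extended linearly; it maps U (x) H into H. *)
Definition contract f (X : galg k (G * G)%type) : galg k G :=
  [ffun h => \sum_g f g * gcoef X (g, h)].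

Lemma gcoef_contract f X h : gcoef (contract f X) h = \sum_g f g * gcoef X (g, h).
Proof. by rewrite {1}/gcoef ffunE. Qed.

Fact contract_is_linear f : linear (contract f).
Proof.
move=> c X Y; apply: galgP => h; rewrite gcoefD gcoefZ !gcoef_contract mulr_sumr -big_split.
by apply: eq_bigr => g _; rewrite gcoefD gcoefZ mulrDr mulrCA.
Qed.
HB.instance Definition _ f := GRing.isLinear.Build k (galg k (G * G)%type) (galg k G)
  *:%R (contract f) (contract_is_linear f).

Lemma contract_tens f u v : contract f (tens u v) = (\sum_g f g * gcoef u g) *: v.
Proof.
apply: galgP => h; rewrite gcoef_contract gcoefZ mulr_suml.
by apply: eq_bigr => g _; rewrite gcoef_tens mulrA.
Qed.

Lemma contract_tensv f U H X : X \in tensv U H -> contract f X \in H.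
Proof.
move=> XUH; have : (tensv U H <= linfun (contract f) @^-1: H)%VS.
  apply/span_subvP => _ /allpairsP[[u v] /= [uU vH ->]].
  by rewrite -memv_preim lfunE /= contract_tens memvZ // vbasis_mem.
by move/subvP/(_ _ XUH); rewrite -memv_preim lfunE.
Qed.

Lemma gelt_subgroup_algebra A g : g \in A -> gelt g \in subgroup_algebra k A.
Proof. by move=> gA; rewrite memv_span // map_f // mem_enum. Qed.

Lemma mem_subgroup_algebra A (x : galg k G) :
  x \in subgroup_algebra k A <-> forall g, g \notin A -> gcoef x g = 0.
Proof.
split=> [xA g gA|x0]; last first.
  rewrite (galgE x); apply: memv_suml => g _.
  have [gA|/x0->] := boolP (g \in A); last by rewrite scale0r mem0v.
  by rewrite memvZ // gelt_subgroup_algebra.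
have := coord_span xA => ->; rewrite gcoef_sum big1 // => -[i ltiA] _.
rewrite gcoefZ; have ltiA' : (i < size (enum A))%N by rewrite -cardE.
rewrite (nth_map 1%g) // gcoef_gelt; case: eqP => [gE|]; last by rewrite mulr0.
by case/negP: gA; rewrite gE -mem_enum mem_nth.
Qed.

Lemma hopf_subgroup_algebra A : hopf_subalgebra (subgroup_algebra k A).
Proof.
have ind (V : {vspace galg k G}) : (forall g, g \in A -> gelt g \in V) ->
    forall x, x \in subgroup_algebra k A -> x \in V.
  move=> AV; apply/subvP/span_subvP => _ /mapP[g gA ->].
  by apply: AV; rewrite -mem_enum.
split.
- by rewrite -gelt1 gelt_subgroup_algebra.
- move=> a b /mem_subgroup_algebra aA /mem_subgroup_algebra bA.
  apply/mem_subgroup_algebra => g gA; rewrite gcoef_mul big1 // => h _.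
  have [hA|/aA->] := boolP (h \in A); last by rewrite mul0r.
  by rewrite bA ?mulr0 // groupMl ?groupV.
- move=> a /mem_subgroup_algebra aA; apply: memv_suml => g _.
  have [gA|/aA->] := boolP (g \in A); last by rewrite scale0r mem0v.
  by rewrite memvZ // -tens_gelt mem_tensv ?gelt_subgroup_algebra.
- move=> a /mem_subgroup_algebra aA; apply: memv_suml => g _.
  have [gA|/aA->] := boolP (g \in A); last by rewrite scale0r mem0v.
  by rewrite memvZ // gelt_subgroup_algebra // groupV.
Qed.

Lemma subgroup_algebra_inj : injective (@subgroup_algebra k G).
Proof.
move=> A B AB; apply/val_inj/setP => g /=.
have sub (C D : {group G}) : subgroup_algebra k C = subgroup_algebra k D -> g \in C -> g \in D.
  move=> CD gC; have := gelt_subgroup_algebra gC; rewrite CD => /mem_subgroup_algebra.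
  move=> gD; apply/negPn/negP => /gD; rewrite gcoef_gelt eqxx => /eqP.
  by rewrite oner_eq0.
by apply/idP/idP; apply: sub.
Qed.

End TensorSubspaces.

(** * The pair (A, b) is determined by R(A, b) *)

Section Rmatrix.
Variables (k : closedFieldType) (G : finGroupType).
Hypothesis char0 : [pchar k] =i pred0.

Section Form.
Variables (A : {group G}) (b : lchar k A -> lchar k A -> k).
Hypotheses (abA : abelian A) (bP : is_inv_alt_form b).
Implicit Types (s t : lchar k A).

Lemma form_1l t : b 1%g t = 1.
Proof.
have := form_bilinear_l bP 1%g 1%g t; rewrite mulg1 => /esym/eqP.
by rewrite -{3}[b 1%g t]mulr1 (inj_eq (mulfI (form_neq0 bP _ _))) => /eqP.
Qed.

Lemma form_1r s : b s 1%g = 1.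
Proof.
have := form_bilinear_r bP s 1%g 1%g; rewrite mulg1 => /esym/eqP.
by rewrite -{3}[b s 1%g]mulr1 (inj_eq (mulfI (form_neq0 bP _ _))) => /eqP.
Qed.

Lemma form_skew s t : b t s = (b s t)^-1.
Proof.
apply: (mulfI (form_neq0 bP s t)); rewrite divff ?(form_neq0 bP) //.
have := form_alternating bP (s * t)%g; rewrite (form_bilinear_l bP) !(form_bilinear_r bP).
by rewrite !(form_alternating bP) mul1r mulr1.
Qed.

(** If t is not 1, non-degeneracy gives s0 with b(s0, t) different from 1, and translating the
    summation index by s0 multiplies the sum by b(s0, t). *)
Lemma sum_form t : \sum_s b s t = #|A|%:R * (t == 1%g)%:R.
Proof.
have [->|t1] := eqVneq t 1%g.
  rewrite (eq_bigr (fun=> 1)) => [|s _]; last exact: form_1r.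
  by rewrite mulr1 -(card_lchar char0 abA) sumr_const cardsT.
have [s0 s0t] : exists s, b s t != 1.
  apply/existsP; apply: contraR t1; rewrite negb_exists => /forallP bt.
  by apply/eqP/(form_nondegenerate_r bP) => s; have := bt s; rewrite negbK => /eqP.
have : b s0 t * (\sum_s b s t) = \sum_s b s t.
  rewrite mulr_sumr [RHS](reindex_inj (mulgI s0)) /=.
  by apply: eq_bigr => s _; rewrite (form_bilinear_l bP).
move/eqP; rewrite -subr_eq0 -{2}[\sum_s _]mul1r -mulrBl mulf_eq0 subr_eq0.
by rewrite (negPf s0t) mulr0 => /eqP.
Qed.

Lemma contract_Rmat s : contract s (Rmat b) = \sum_t b s t *: idem t.
Proof.
have A0 := natr_neq0 char0 (cardG_gt0 A).
have cI s' : \sum_g s g * gcoef (idem s') g = (s == s')%:R.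
  rewrite -(char_ext_idem s s' A0) [RHS]big_mkcond; apply: eq_bigr => g _ /=.
  by case: ifP => [_|/negbT gA]; rewrite mulrC // lchar0 ?mulr0.
have cE s' t : contract s (b s' t *: tens (idem s') (idem t)) = (s == s')%:R *: (b s' t *: idem t).
  by rewrite linearZ /= contract_tens cI !scalerA mulrC.
have cS s' : contract s (\sum_t b s' t *: tens (idem s') (idem t)) =
    (s == s')%:R *: \sum_t b s' t *: idem t.
  by rewrite linear_sum scaler_sumr; apply: eq_bigr => t _; apply: cE.
rewrite /Rmat linear_sum (eq_bigr _ (fun s' _ => cS s')) (bigD1 s) //= eqxx scale1r
  [X in _ + X]big1 ?addr0 // => s'.
by rewrite eq_sym => /negPf->; rewrite scale0r.
Qed.

Lemma idem_subgroup_algebra s : idem s \in subgroup_algebra k A.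
Proof.
by apply/mem_subgroup_algebra => g gA; rewrite gcoef_idem lchar0 ?mulr0 // groupV.
Qed.

Lemma Rmat_tensv : Rmat b \in tensv (subgroup_algebra k A) (subgroup_algebra k A).
Proof.
rewrite memv_suml // => s _; rewrite memv_suml // => t _.
by rewrite memvZ // mem_tensv ?idem_subgroup_algebra.
Qed.

(* By non-degeneracy every idempotent e_t is a combination of the contractions *)
(* (s (x) id)(R(A, b)).                                                        *)
Lemma Rmat_minimal (U H : {vspace galg k G}) :
  Rmat b \in tensv U H -> (subgroup_algebra k A <= H)%VS.
Proof.
move=> RH; have A0 := natr_neq0 char0 (cardG_gt0 A).
have idemH t : idem t \in H.
  (* Fourier inversion: the weights b(s, t^-1) turn the coefficient of e_t' into the sum over s of
     b(s, t^-1 t'), which vanishes unless t' = t. *)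
  have -> : idem t = #|A|%:R^-1 *: \sum_s b s t^-1%g *: contract s (Rmat b).
    under eq_bigr do rewrite contract_Rmat scaler_sumr.
    rewrite exchange_big (bigD1 t) //= [X in _ + X]big1 ?addr0 => [|t' t't].
      rewrite (eq_bigr (fun s => b s 1%g *: idem t)) => [|s _]; last first.
        by rewrite scalerA -(form_bilinear_r bP) mulVg.
      by rewrite -scaler_suml sum_form eqxx mulr1 scalerA mulVf // scale1r.
    rewrite (eq_bigr (fun s => b s (t^-1 * t')%g *: idem t')) => [|s _]; last first.
      by rewrite scalerA -(form_bilinear_r bP).
    rewrite -scaler_suml sum_form -(inj_eq (mulgI t)) mulKVg mulg1 (negPf t't).
    by rewrite mulr0 scale0r.
  rewrite memvZ // memv_suml // => s _; rewrite memvZ //; exact: contract_tensv RH.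
apply/span_subvP => _ /mapP[a + ->]; rewrite mem_enum => aA.
by rewrite (gelt_sum_idem char0 abA aA) memv_suml // => s _; rewrite memvZ.
Qed.

End Form.

(** Minimality applied in both directions identifies the two subgroups; then b(s, t) is recovered as
    (s (x) t)(R). *)
Lemma eq_form_pair (p q : form_pair k G) :
  Rmat (@fp_form _ _ p) = Rmat (@fp_form _ _ q) -> p = q.
Proof.
case: p q => [A b abA nA bP] [B c abB nB cP] /= Rbc.
have AB : A = B.
  apply: (@subgroup_algebra_inj k G); apply: subv_anti; apply/andP; split.
    apply: (@Rmat_minimal _ _ abA bP (subgroup_algebra k B)).
    by rewrite Rbc Rmat_tensv.
  apply: (@Rmat_minimal _ _ abB cP (subgroup_algebra k A)).
  by rewrite -Rbc Rmat_tensv.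
subst B; have A0 := natr_neq0 char0 (cardG_gt0 A).
have bc : b = c.
  apply: funext => s; apply: funext => t.
  have eval (d : lchar k A -> lchar k A -> k) : char_ext t (contract s (Rmat d)) = d s t.
    rewrite contract_Rmat /char_ext.
    under eq_bigr do rewrite gcoef_sum mulr_suml.
    rewrite exchange_big (bigD1 t) //= [X in _ + X]big1 ?addr0 => [|t' t't].
      under eq_bigr do rewrite gcoefZ -mulrA.
      by rewrite -mulr_sumr [X in _ * X](char_ext_idem t t A0) eqxx mulr1.
    under eq_bigr do rewrite gcoefZ -mulrA.
    by rewrite -mulr_sumr [X in _ * X](char_ext_idem t t' A0) eq_sym (negPf t't) mulr0.
  by rewrite -(eval b) -(eval c) Rbc.
subst c; congr FormPair; exact: Prop_irrelevance.
Qed.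

(** The Hopf-theoretic clauses of [is_Theta] follow from the formula for R, so that finding Theta F
    amounts to solving R_F = R(A, b). *)
Lemma is_ThetaP (F : inv_twist k G) (p : form_pair k G) :
  is_Theta F p <-> Rtwist F = Rmat (@fp_form _ _ p).
Proof.
split=> [[]//|RE]; split; rewrite ?RE ?Rmat_tensv //; first exact: hopf_subgroup_algebra.
by move=> H _; apply: Rmat_minimal; [apply: fp_abelian|apply: fp_formP].
Qed.

End Rmatrix.

(** * The R-matrix of an invariant twist *)

Lemma sum_pair (V : nmodType) (I J : finType) (F : I * J -> V) :
  \sum_p F p = \sum_i \sum_j F (i, j).
Proof. by rewrite pair_big; apply: eq_bigr => -[]. Qed.

(** The hypothesis says that y has a preimage under f exactly when [P y] holds, and that this
    preimage is then only [f' y]. *)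
Lemma gcoef_gext (k : fieldType) (G H : finGroupType) (f : G -> H) (P : pred H) (f' : H -> G)
    (X : galg k G) y :
  (forall x, (y == f x) = P y && (f' y == x)) ->
  gcoef (gext f X) y = (P y)%:R * gcoef X (f' y).
Proof.
move=> fE; rewrite /gext gcoef_sum (bigD1 (f' y)) //= big1 ?addr0 => [|x /negPf xf].
  by rewrite gcoefZ gcoef_gelt fE eqxx andbT mulrC.
by rewrite gcoefZ gcoef_gelt fE eq_sym xf andbF mulr0.
Qed.

Section UnitRing.
Variable R : unitRingType.
Implicit Types x y c d m : R.

Lemma unitr_mul x y : x \is a GRing.unit -> y \is a GRing.unit -> x * y \is a GRing.unit.
Proof. by move=> ux uy; rewrite unitrMr. Qed.

(** The elimination behind the hexagon identity: c and d come from the two sides of the cocycle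
    identity, m and c' from its permuted forms. All of them are expressed through c, and x12 cancels
    because it commutes with c and c'. *)
Lemma hexagon_of_cocycle x12 x13 x23 y13 y23 c c' d m :
  x12 \is a GRing.unit -> x13 \is a GRing.unit -> x23 \is a GRing.unit ->
  c \is a GRing.unit -> x12 * c = x23 * d -> y13 * m = x12 * c' ->
  x13 * m = y23 * d -> c * x12 = x12 * c -> c' * x12 = x12 * c' ->
  c' * c^-1 = y13 * x13^-1 * (y23 * x23^-1).
Proof.
move=> u12 u13 u23 uc cd yc xm cC c'C; apply: (mulIr uc); rewrite mulrVK //.
apply: (mulIr u12); rewrite c'C -yc -(mulKr u13 m) xm -(mulKr u23 d) -cd -cC.
by rewrite !mulrA.
Qed.

End UnitRing.

Section RMatrixOfTwist.
Variables (k : closedFieldType) (G : finGroupType).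
Implicit Types (F X Y : galg k (G * G)%type) (g h x : G).

Definition leg13 : galg k (G * G)%type -> galg k (G * G * G)%type :=
  gext (fun p => (p.1, 1%g, p.2)).

Lemma leg13M : {morph leg13 : X Y / X * Y}.
Proof.
by apply: gextM => -[x x'] [y y']; congr (_, _, _); rewrite mulg1.
Qed.

Lemma flipM : {morph @flip k G : X Y / X * Y}.
Proof. by apply: gextM => -[? ?] [? ?]. Qed.

Lemma flipK : involutive (@flip k G).
Proof.
move=> X; rewrite /flip gext_comp [RHS]galgE; apply: eq_bigr => -[g h] _ //.
Qed.

Lemma flip_unit F : F \is a GRing.unit -> flip F \is a GRing.unit.
Proof. by apply: gext_unit => -[? ?] [? ?]. Qed.

Lemma flipV F : F \is a GRing.unit -> flip F^-1 = (flip F)^-1.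
Proof. by apply: gextV => -[? ?] [? ?]. Qed.

Lemma flip_coprod (a : galg k G) : flip (coprod a) = coprod a.
Proof. by rewrite /flip /coprod gext_comp. Qed.

Lemma flip_invariant F : is_invariant F -> is_invariant (flip F).
Proof. by move=> iF a; rewrite -{1}flip_coprod -flipM iF flipM flip_coprod. Qed.

Lemma invariantM F F' : is_invariant F -> is_invariant F' -> is_invariant (F * F').
Proof. by move=> iF iF' a; rewrite mulrA iF -!mulrA iF'. Qed.

Lemma Rtwist_invariant F : is_inv_twist F -> is_invariant (Rtwist F).
Proof.
move=> tF; apply: invariantM; first exact: flip_invariant tF.2.
exact: (inv_twistV tF).2.
Qed.

Lemma Rtwist_unit F : is_inv_twist F -> Rtwist F \is a GRing.unit.
Proof. by move=> [[uF _] _]; apply: unitr_mul; [exact: flip_unit|rewrite unitrV]. Qed.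

Lemma flip_Rtwist F : is_inv_twist F -> flip (Rtwist F) = (Rtwist F)^-1.
Proof.
move=> [[uF _] _]; rewrite /Rtwist flipM flipK flipV //.
by rewrite invrM ?unitrV ?flip_unit // invrK.
Qed.

(* E1 and E2 below are the cocycle identity with its tensor factors permuted   *)
(* cyclically and transposed; they express (Delta (x) id)(F_21) through        *)
(* (id (x) Delta)(F), and invariance of F removes the remaining conjugation by *)
(* F_12.                                                                       *)
Lemma coprod_id_Rtwist F : is_inv_twist F ->
  coprod_id (Rtwist F) = leg13 (Rtwist F) * leg23 (Rtwist F).
Proof.
move=> [[uF cF] iF].
pose cyc := gext (fun t : G * G * G => (t.1.2, t.2, t.1.1)) : galg k _ -> galg k _.
pose sw := gext (fun t : G * G * G => (t.1.1, t.2, t.1.2)) : galg k _ -> galg k _.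
(* Delta is applied to the first factor of F and its two copies go to positions 1 and 3; this is the
   image of [coprod_id F] under both [cyc] and [sw]. *)
pose M := gext (fun p : G * G => (p.1, p.2, p.1)) F.
have cycM : {morph cyc : X Y / X * Y} by apply: gextM => -[[? ?] ?] [[? ?] ?].
have swM : {morph sw : X Y / X * Y} by apply: gextM => -[[? ?] ?] [[? ?] ?].
have E1 : leg13 (flip F) * M = leg12 F * coprod_id (flip F).
  have := congr1 cyc cF; rewrite !cycM /cyc /leg12 /leg23 /coprod_id /id_coprod !gext_comp.
  by rewrite /leg13 /flip !gext_comp.
have E2 : leg13 F * M = leg23 (flip F) * id_coprod F.
  have := congr1 sw cF; rewrite !swM /sw /leg12 /leg23 /coprod_id /id_coprod !gext_comp.
  by [].
have m13 : {morph (fun p : G * G => (p.1, 1%g : G, p.2)) : x y / (x * y)%g}.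
  by move=> [? ?] [? ?]; congr (_, _, _); rewrite mulg1.
have m12 : {morph (fun p : G * G => (p.1, p.2, 1%g : G)) : x y / (x * y)%g}.
  by move=> [? ?] [? ?]; congr (_, _, _); rewrite mulg1.
have m23 : {morph (fun p : G * G => (1%g : G, p.1, p.2)) : x y / (x * y)%g}.
  by move=> [? ?] [? ?]; congr (_, _, _); rewrite mulg1.
have mc : {morph (fun p : G * G => (p.1, p.1, p.2)) : x y / (x * y)%g} by [].
have u12 : leg12 F \is a GRing.unit := gext_unit m12 uF.
have u13 : leg13 F \is a GRing.unit := gext_unit m13 uF.
have u23 : leg23 F \is a GRing.unit := gext_unit m23 uF.
have uc : coprod_id F \is a GRing.unit := gext_unit mc uF.
have V13 : leg13 F^-1 = (leg13 F)^-1 := gextV m13 uF.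
have V23 : leg23 F^-1 = (leg23 F)^-1 := gextV m23 uF.
have Vc : coprod_id F^-1 = (coprod_id F)^-1 := gextV mc uF.
rewrite /Rtwist coprod_idM leg13M leg23M V13 V23 Vc.
apply: (hexagon_of_cocycle u12 u13 u23 uc cF E1 E2); exact: leg12_coprod_id.
Qed.

Lemma gcoef_leg13 X a b c : gcoef (leg13 X) (a, b, c) = (b == 1%g)%:R * gcoef X (a, c).
Proof.
rewrite (gcoef_gext X (P := fun t => t.1.2 == 1%g) (f' := fun t => (t.1.1, t.2))) // => -[p q].
by rewrite /= !xpair_eqE andbAC andbC.
Qed.

Lemma gcoef_leg23 X a b c : gcoef (leg23 X) (a, b, c) = (a == 1%g)%:R * gcoef X (b, c).
Proof.
rewrite (gcoef_gext X (P := fun t => t.1.1 == 1%g) (f' := fun t => (t.1.2, t.2))) // => -[p q].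
by rewrite /= !xpair_eqE andbA.
Qed.

Lemma gcoef_coprod_id X g g' h :
  gcoef (coprod_id X) (g, g', h) = (g == g')%:R * gcoef X (g, h).
Proof.
rewrite (gcoef_gext X (P := fun t => t.1.1 == t.1.2) (f' := fun t => (t.1.1, t.2))) // => -[p q].
by rewrite /= !xpair_eqE andbA (eq_sym g); case: (eqVneq g' g) => [->|]; rewrite ?andbb //;
  case: (eqVneq g p) => // ->; case: eqP.
Qed.

Lemma gcoef_flip X g h : gcoef (flip X) (g, h) = gcoef X (h, g).
Proof.
rewrite (gcoef_gext X (P := xpredT) (f' := fun t => (t.2, t.1))) ?mul1r // => -[p q].
by rewrite /= !xpair_eqE andbC.
Qed.

Lemma gcoef_leg13_leg23 X Y g g' h :
  gcoef (leg13 X * leg23 Y) (g, g', h) =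
  \sum_y gcoef X (g, y) * gcoef Y (g', (y^-1 * h)%g).
Proof.
rewrite gcoef_mul sum_pair exchange_big; apply: eq_bigr => y _ /=.
have E a b : gcoef (leg13 X) (a, b, y) * gcoef (leg23 Y) ((a, b, y)^-1 * (g, g', h))%g =
    (b == 1%g)%:R * gcoef X (a, y) * ((a == g)%:R * gcoef Y ((b^-1 * g')%g, (y^-1 * h)%g)).
  rewrite gcoef_leg13 [X in _ * X](gcoef_leg23 Y (a^-1 * g) (b^-1 * g') (y^-1 * h)).
  by rewrite -eq_mulVg1.
rewrite (bigD1 (g, 1%g)) //= E !eqxx !mul1r invg1 mul1g big1 ?addr0 // => -[a b] ab1.
rewrite E; move: ab1; rewrite xpair_eqE; case: (b == 1%g); last by rewrite !mul0r.
by rewrite andbT => /negPf->; rewrite mul0r mulr0.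
Qed.

Section Coefficients.
Variable F : galg k (G * G)%type.
Hypothesis tF : is_inv_twist F.
Let r g h := gcoef (Rtwist F) (g, h).

(** The hexagon identity read on coefficients: the rows r_g are orthogonal idempotents. *)
Lemma Rtwist_row_idem g g' h :
  \sum_y r g y * r g' (y^-1 * h)%g = (g == g')%:R * r g h.
Proof. by rewrite -gcoef_leg13_leg23 -coprod_id_Rtwist // gcoef_coprod_id. Qed.

(** This says (eps (x) id)(R) = 1. Applying the counit to the first two factors of the hexagon
    identity shows that this element is idempotent, and it is invertible. *)
Lemma Rtwist_sum_row h : \sum_g r g h = (h == 1%g)%:R.
Proof.
have m2 : {morph (fun p : G * G => p.2) : x y / (x * y)%g} by [].
pose a := gext (fun p : G * G => p.2) (Rtwist F).
have ua : a \is a GRing.unit := gext_unit m2 (Rtwist_unit tF).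
have /(mulrI ua)/(congr1 (fun u => gcoef u h)) : a * a = a * 1.
  have m3 : {morph (fun t : G * G * G => t.2) : x y / (x * y)%g} by [].
  have := congr1 (gext (fun t : G * G * G => t.2)) (coprod_id_Rtwist tF).
  by rewrite (gextM m3) /leg13 /leg23 /coprod_id !gext_comp mulr1.
rewrite -gelt1 gcoef_gelt => <-; rewrite /a /gext gcoef_sum.
rewrite sum_pair; apply: eq_bigr => g _; rewrite (bigD1 h) //= big1 ?addr0.
  by rewrite gcoefZ gcoef_gelt eqxx mulr1.
by move=> y /negPf yh; rewrite gcoefZ gcoef_gelt eq_sym yh mulr0.
Qed.

(* Both R_21 and (S (x) id)(R) are inverse to R. *)
Lemma Rtwist_skew g h : r g h = r h^-1%g g.
Proof.
pose R' := gext (fun p : G * G => (p.1^-1%g, p.2)) (Rtwist F).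
have R'E x y : gcoef R' (x, y) = r x^-1%g y.
  rewrite (gcoef_gext _ (P := xpredT) (f' := fun t => (t.1^-1%g, t.2))) /= ?mul1r // => -[p q].
  by rewrite /= !xpair_eqE (inv_eq invgK).
suff R'R : R' * Rtwist F = 1.
  have := flip_Rtwist tF; have -> : (Rtwist F)^-1 = R'.
    by rewrite -[LHS]mul1r -R'R mulrK // Rtwist_unit.
  by move/(congr1 (fun u => gcoef u (h, g))); rewrite gcoef_flip R'E.
apply: galgP => -[u v]; rewrite gcoef_mul -gelt1 gcoef_gelt.
rewrite sum_pair; under eq_bigr => x _.
  under eq_bigr do rewrite R'E.
  rewrite (Rtwist_row_idem x^-1%g (x^-1 * u)%g v) -[X in X == _]mulg1 (inj_eq (mulgI _)); over.
rewrite -mulr_sumr (reindex_inj invg_inj) /=.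
under eq_bigr do rewrite invgK.
by rewrite Rtwist_sum_row -natrM mulnb xpair_eqE eq_sym.
Qed.

Lemma Rtwist_conj g h x : r (g ^ x)%g (h ^ x)%g = r g h.
Proof.
have := congr1 (fun u => gcoef u ((g * x)%g, (h * x)%g)) (Rtwist_invariant tF (gelt x)).
rewrite coprod_gelt !gcoef_mul (bigD1 (x, x)) //= big1 ?addr0; last first.
  by move=> y /negPf yx; rewrite gcoef_gelt yx mul0r.
rewrite [RHS](bigD1 (g, h)) //= [X in _ + X]big1 ?addr0; last first.
  move=> [p q] /negPf pq; rewrite [X in _ * X]gcoef_gelt xpair_eqE /=.
  rewrite -(inj_eq (mulgI p) (p^-1 * (g * x))%g) -(inj_eq (mulgI q) (q^-1 * (h * x))%g).
  rewrite !mulKVg !(inj_eq (mulIg x)).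
  by rewrite -xpair_eqE eq_sym pq mulr0.
rewrite !gcoef_gelt eqxx mul1r [X in _ = _ * X](_ : _ = 1) ?mulr1; last first.
  by rewrite xpair_eqE /= !mulKg !eqxx.
by [].
Qed.

(** [T] takes the coefficient of 1 in the product of the two tensor factors. On group elements, [TM]
    compares p'qpq' with its conjugate qpq'p'; it then gives T(F_21 F^-1) = T(F^-1 F) = T(1). *)
Lemma Rtwist_sum_diag : \sum_g r g g^-1%g = 1.
Proof.
pose T (X : galg k (G * G)%type) := gcoef (gext (fun p : G * G => (p.1 * p.2)%g) X) 1%g.
have TE X : T X = \sum_g gcoef X (g, g^-1%g).
  rewrite /T /gext gcoef_sum sum_pair.
  apply: eq_bigr => g _; rewrite (bigD1 g^-1%g) //= big1 ?addr0.
    by rewrite gcoefZ gcoef_gelt mulgV eqxx mulr1.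
  move=> y /negPf yg; rewrite gcoefZ gcoef_gelt eq_sym.
  by rewrite -(inj_eq (mulgI g^-1%g)) mulKg mulg1 yg mulr0.
have TM X Y : T (flip X * Y) = T (Y * X).
  rewrite (galgE X) (galgE Y) /flip linear_sum /= !mulr_suml.
  rewrite (eq_bigr (fun p =>
    \sum_q (gcoef X p * gcoef Y q) *: (gelt (p.2, p.1) * gelt q))); last first.
    move=> p _; rewrite mulr_sumr; apply: eq_bigr => q _.
    by rewrite linearZ /= gext_gelt -scalerAl -scalerAr scalerA.
  rewrite [in RHS](eq_bigr (fun q =>
    \sum_p (gcoef X p * gcoef Y q) *: (gelt q * gelt p))); last first.
    move=> q _; rewrite mulr_sumr; apply: eq_bigr => p _.
    by rewrite -scalerAl -scalerAr scalerA mulrC.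
  rewrite [in RHS]exchange_big /T !linear_sum !gcoef_sum /=; apply: eq_bigr => -[p p'] _.
  rewrite !linear_sum !gcoef_sum /=; apply: eq_bigr => -[q q'] _.
  rewrite !linearZ /= !gcoefZ -!geltM !gext_gelt !gcoef_gelt /=; congr (_ * (nat_of_bool _)%:R).
  rewrite !(eq_sym 1%g) -[RHS](inj_eq (conjg_inj p'^-1%g)) conj1g conjgE invgK.
  by rewrite !mulgA mulgK.
rewrite -TE TM mulVr ?tF.1.1 // TE (bigD1 1%g) //= big1 ?addr0 -?gelt1 ?gcoef_gelt.
  by rewrite invg1 eqxx.
by move=> g /negPf g1; rewrite gcoef_gelt xpair_eqE g1.
Qed.

End Coefficients.
End RMatrixOfTwist.

(** * The subgroup A and the form b of an R-matrix *)

Section FormOfTwist.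
Variables (k : closedFieldType) (G : finGroupType) (F : galg k (G * G)%type).
Hypotheses (char0 : [pchar k] =i pred0) (tF : is_inv_twist F).
Implicit Types (g h x : G).
Let r g h := gcoef (Rtwist F) (g, h).
Let row g : galg k G := [ffun h => r g h].

Let gcoef_row g h : gcoef (row g) h = r g h.
Proof. by rewrite /gcoef ffunE. Qed.

Let rowM g g' : row g * row g' = (g == g')%:R *: row g.
Proof.
apply: galgP => h; rewrite gcoef_mul gcoefZ gcoef_row -Rtwist_row_idem //.
by apply: eq_bigr => y _; rewrite !gcoef_row.
Qed.

(** The skew symmetry r(g, h) = r(h^-1, g) turns the row identity into one for columns. *)
Let col_idem g h h' : \sum_x r x h * r (x^-1 * g)%g h' = (h == h')%:R * r g h.
Proof.
rewrite /r (Rtwist_skew tF g) -(inj_eq invg_inj h) -Rtwist_row_idem //.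
by apply: eq_bigr => x _; rewrite (Rtwist_skew tF x) (Rtwist_skew tF _ h').
Qed.

(** The elements occurring in the second factor of R; by skew symmetry the first factor of R is
    supported here too. *)
Definition twist_support : {set G} := [set h | [exists g, r g h != 0]].

Let supportP h : reflect (exists g, r g h != 0) (h \in twist_support).
Proof. by rewrite inE; apply: existsP. Qed.

(** With g chosen so that r(g, h) is nonzero, [col_idem] divided by r(g, h) displays h as a
    combination of rows. Hence A lies in a commutative algebra spanned by orthogonal idempotents. *)
Let gelt_row h : h \in twist_support -> exists c, gelt h = \sum_x c x *: row x.
Proof.
move=> /supportP[g rgh]; exists (fun x => (r g h)^-1 * r (x^-1 * g)%g h).
apply: (scalerI rgh); apply: galgP => h'; rewrite gcoefZ gcoef_gelt scaler_sumr gcoef_sum.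
transitivity (\sum_x r x h' * r (x^-1 * g)%g h).
  by rewrite col_idem mulrC; case: eqP => [->|]; rewrite ?mul0r.
by apply: eq_bigr => x _; rewrite !gcoefZ gcoef_row mulrA mulVKf // mulrC.
Qed.

Let row_sumM (c d : G -> k) :
  (\sum_x c x *: row x) * (\sum_x d x *: row x) = \sum_x (c x * d x) *: row x.
Proof.
rewrite mulr_suml; apply: eq_bigr => x _; rewrite mulr_sumr (bigD1 x) //= big1 ?addr0.
  by rewrite -scalerAl -scalerAr rowM eqxx scale1r scalerA.
by move=> y; rewrite -scalerAl -scalerAr rowM eq_sym => /negPf->; rewrite scale0r !scaler0.
Qed.

Fact twist_support_group_set : group_set twist_support.
Proof.
apply/group_setP; split=> [|h h' /gelt_row[c hE] /gelt_row[d h'E]]; apply/supportP.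
  apply/existsP; apply: contraT; rewrite negb_exists => /forallP r0.
  have := Rtwist_sum_row tF 1%g; rewrite big1 => [/eqP|g _]; last first.
    by have := r0 g; rewrite negbK => /eqP.
  by rewrite eqxx eq_sym oner_eq0.
(* The product h h' is again a combination of rows, so it must occur in one of them. *)
apply/existsP; apply: contraT; rewrite negb_exists => /forallP r0.
have := congr1 (fun a => gcoef a (h * h')%g) (geltM k h h').
rewrite hE h'E row_sumM gcoef_gelt eqxx gcoef_sum big1 => [/eqP|x _]; first by rewrite oner_eq0.
by have := r0 x; rewrite negbK gcoefZ gcoef_row => /eqP->; rewrite mulr0.
Qed.
Canonical twist_support_group := Group twist_support_group_set.
Local Notation A := twist_support_group.

Lemma twist_support_abelian : abelian A.
Proof.
apply/centsP => h /gelt_row[c hE] h' /gelt_row[d h'E]; apply: (@gelt_inj k).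
by rewrite !geltM hE h'E !row_sumM; apply: eq_bigr => x _; rewrite mulrC.
Qed.

Lemma twist_support_normal : (A <| [set: G])%g.
Proof.
apply/andP; split; first exact: finset.subsetT.
apply/fintype.subsetP => x _; rewrite finset.inE.
apply/fintype.subsetP => _ /imsetP[h /supportP[g rgh] ->].
by apply/supportP; exists (g ^ x)%g; rewrite /r Rtwist_conj.
Qed.

Let supportr g h : h \notin A -> r g h = 0.
Proof. by move=> hA; apply/eqP; apply: contraR hA => rgh; apply/supportP; exists g. Qed.

Let supportl g h : g \notin A -> r g h = 0.
Proof. by move=> gA; rewrite /r (Rtwist_skew tF) -/(r _ _) supportr. Qed.

Definition twist_form (s t : lchar k A) : k := \sum_g s g * \sum_h r g h * t h.
Local Notation b := twist_form.
Implicit Types (s t : lchar k A).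

Let rho t g := \sum_h r g h * t h.

(** [rho t g] is t(r_g). Since t is multiplicative on k[A], these scalars are again orthogonal
    idempotents, which makes b multiplicative in its first argument. *)
Let rhoM t g g' : rho t g * rho t g' = (g == g')%:R * rho t g.
Proof.
rewrite mulr_suml; under eq_bigr do rewrite mulr_sumr.
transitivity (\sum_h \sum_y r g y * r g' (y^-1 * h)%g * t h).
  rewrite [RHS]exchange_big; apply: eq_bigr => y _ /=.
  rewrite (reindex_inj (mulgI y^-1%g)); apply: eq_bigr => h _ /=.
  have [yA|yA] := boolP (y \in A); last by rewrite (supportr g yA) !mul0r.
  have [hA|hA] := boolP (h \in A).
    by rewrite mulrACA -lcharM ?groupM ?groupV // mulKVg.
  by rewrite (lchar0 t hA) mulr0 [t (y^-1 * h)%g]lchar0 ?mulr0 // groupMl ?groupV.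
rewrite /rho mulr_sumr; apply: eq_bigr => h _.
by rewrite -mulr_suml (Rtwist_row_idem tF) mulrA.
Qed.

Let form_mull s s' t : b (s * s')%g t = b s t * b s' t.
Proof.
rewrite [RHS]mulr_suml; apply: eq_bigr => g _.
rewrite [RHS]mulr_sumr [RHS](bigD1 g) //= [X in _ + X]big1.
  by rewrite addr0 mulrACA -!/(rho t g) rhoM eqxx mul1r ffunE.
by move=> g'; rewrite mulrACA -/(rho t g) -/(rho t g') rhoM eq_sym => /negPf->; rewrite mul0r mulr0.
Qed.

Let form_1 t : b 1%g t = 1.
Proof.
transitivity (\sum_g rho t g).
  apply: eq_bigr => g _; rewrite lchar_1E; have [gA|gA] := boolP (g \in A); rewrite ?mul1r //.
  by rewrite mul0r /rho big1 // => h _; rewrite supportl ?mul0r.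
rewrite /rho exchange_big (bigD1 1%g) //= [X in _ + X]big1 => [|h /negPf h1].
  by rewrite -mulr_suml (Rtwist_sum_row tF) eqxx lchar1 mulr1 addr0.
by rewrite -mulr_suml (Rtwist_sum_row tF) h1 mul0r.
Qed.

Let form_swap s t : b s t = b t^-1%g s.
Proof.
rewrite /b; under eq_bigr do rewrite mulr_sumr.
rewrite exchange_big (reindex_inj invg_inj); apply: eq_bigr => h _ /=.
rewrite mulr_sumr ffunE; apply: eq_bigr => g _.
by rewrite /r (Rtwist_skew tF g) invgK mulrC mulrAC mulrC.
Qed.

Let form_mulr s t t' : b s (t * t')%g = b s t * b s t'.
Proof. by rewrite !(form_swap s) invMg form_mull mulrC. Qed.

(** Fourier inversion in the first argument: [rho t] can be read off from b. *)
Let sum_form_lchar t u : \sum_s b s t * s u^-1%g = #|A|%:R * rho t u.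
Proof.
under eq_bigr do rewrite mulr_suml; rewrite exchange_big (bigD1 u) //= [X in _ + X]big1.
  rewrite addr0 (eq_bigr (fun s => s u * s u^-1%g * rho t u)) => [|s _]; last by rewrite mulrAC.
  rewrite -mulr_suml (sum_lchar_mulV char0 twist_support_abelian) eqxx /=.
  have [uA|uA] := boolP (u \in A); first by rewrite mulr1.
  by rewrite mulr0 mul0r /rho big1 ?mulr0 // => h _; rewrite supportl ?mul0r.
move=> g /negPf gu.
rewrite (eq_bigr (fun s => s g * s u^-1%g * rho t g)) => [|s _]; last by rewrite mulrAC.
by rewrite -mulr_suml (sum_lchar_mulV char0 twist_support_abelian) gu mulr0 mul0r.
Qed.

Let A0 : #|A|%:R != 0 :> k.
Proof. by rewrite natr_neq0 ?cardG_gt0. Qed.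

(** If b(s, t) = 1 for all s, then t(r_g) is 1 for g = 1 and 0 otherwise. Applying t to the
    expansion of h in rows leaves only the coefficient of r_1, which is 1. *)
Let form_nondegr t : (forall s, b s t = 1) -> t = 1%g.
Proof.
move=> b1; apply: lchar_eqP => h hA; rewrite lchar_1E hA.
have rho1 u : rho t u = (u == 1%g)%:R.
  have [uA|uA] := boolP (u \in A); last first.
    rewrite /rho big1 => [|h' _]; last by rewrite supportl ?mul0r.
    by case: eqP uA => // ->; rewrite group1.
  apply: (mulfI A0); rewrite -sum_form_lchar; under eq_bigr do rewrite b1 mul1r.
  by rewrite (sum_lchar_dual char0 twist_support_abelian) ?groupV // invg_eq1.
have /supportP[g rgh] := hA; apply: (mulfI rgh); rewrite mulr1.
transitivity (\sum_x r (x^-1 * g)%g h * rho t x).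
  rewrite [RHS](eq_bigr (fun x => \sum_h' r x h' * r (x^-1 * g)%g h * t h')) => [|x _].
    rewrite exchange_big (bigD1 h) //= [X in _ + X]big1 => [|h' /negPf h'h].
      by rewrite addr0 -mulr_suml col_idem eqxx mul1r.
    by rewrite -mulr_suml col_idem h'h !mul0r.
  by rewrite mulr_sumr; apply: eq_bigr => h' _; rewrite mulrA [r x h' * _]mulrC.
rewrite (bigD1 1%g) //= big1 => [|x /negPf x1]; last by rewrite rho1 x1 mulr0.
by rewrite addr0 rho1 eqxx mulr1 invg1 mul1g.
Qed.

Let form_alt s : b s s = 1.
Proof.
have bb t : b t t = 1 \/ b t t = -1.
  have : b t t ^+ 2 = 1 by rewrite expr2 {2}form_swap -form_mull mulgV form_1.
  by move/eqP; rewrite sqrf_eq1 => /orP[]/eqP; [left|right].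
(* Orthogonality leaves only the antidiagonal terms r(g, g^-1), whose sum is 1. *)
have sumb : \sum_t b t t = #|A|%:R.
  transitivity (#|A|%:R * \sum_g r g g^-1%g); last by rewrite (Rtwist_sum_diag tF) mulr1.
  rewrite mulr_sumr.
  rewrite exchange_big; apply: eq_bigr => g _ /=.
  under eq_bigr do rewrite mulr_sumr; rewrite exchange_big (bigD1 g^-1%g) //= [X in _ + X]big1.
    rewrite addr0 (eq_bigr (fun t => t g * t g^-1%g * r g g^-1)) => [|t _]; last first.
      by rewrite [r _ _ * _]mulrC mulrA.
    rewrite -mulr_suml (sum_lchar_mulV char0 twist_support_abelian) eqxx /=.
    have [gA|gA] := boolP (g \in A); first by rewrite mulr1.
    by rewrite supportl // !mulr0.
  move=> h hg; rewrite (eq_bigr (fun t => t g * t (h^-1)^-1%g * r g h)) => [|t _]; last first.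
    by rewrite invgK [r _ _ * _]mulrC mulrA.
  rewrite -mulr_suml (sum_lchar_mulV char0 twist_support_abelian) -(inj_eq invg_inj) invgK.
  by rewrite eq_sym (negPf hg) mulr0 mul0r.
case: (bb s) => // bs; pose N := [set t | b t t != 1].
(* Each term is 0 or 2, so the sum counts the t with b(t, t) = -1 twice; it is also 0, and s would
   contribute to the count. *)
have : \sum_t (1 - b t t) = (2 * #|N|)%:R.
  rewrite natrM mulr_natr -sumr_const [RHS]big_mkcond; apply: eq_bigr => t _.
  rewrite finset.inE; case: (bb t) => ->; rewrite ?eqxx ?subrr // opprK.
  by case: eqP => // e; rewrite -[X in _ + X]e subrr.
rewrite sumrB sumb sumr_const -cardsT (card_lchar char0 twist_support_abelian) subrr.
have N0 : (0 < 2 * #|N|)%N.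
  rewrite muln_gt0 /= card_gt0; apply/set0Pn; exists s; rewrite finset.inE bs.
  by rewrite -subr_eq0 -opprD oppr_eq0 -(natrD _ 1 1) natr_neq0.
by move/esym/eqP; rewrite (negPf (natr_neq0 char0 N0)).
Qed.

Lemma twist_formP : is_inv_alt_form twist_form.
Proof.
split=> //.
- move=> s t; apply/eqP => bst; have := form_1 t.
  by rewrite -(mulgV s) form_mull bst mul0r => /eqP; rewrite eq_sym oner_eq0.
- move=> s bs; apply: form_nondegr => t.
  by rewrite -[t]invgK -form_swap; apply: bs.
- move=> x s t; have NA : x \in 'N(A)%g.
    by apply: (fintype.subsetP (normal_norm twist_support_normal)); rewrite finset.in_setT.
  rewrite /twist_form (reindex_inj (conjg_inj x)); apply: eq_bigr => g _ /=.
  rewrite (reindex_inj (conjg_inj x)) /= !ffunE NA conjgK; congr (_ * _).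
  by apply: eq_bigr => h _; rewrite ffunE NA conjgK /r Rtwist_conj.
Qed.

(** Fourier inversion in both arguments recovers the coefficients of R from b. *)
Lemma Rtwist_Rmat : Rtwist F = Rmat twist_form.
Proof.
apply: galgP => -[u v]; rewrite gcoef_sum -/(r u v).
transitivity (\sum_s (\sum_t b s t * t v^-1%g) * s u^-1%g * (#|A|%:R^-1 * #|A|%:R^-1)); last first.
  apply: eq_bigr => s _; rewrite gcoef_sum !mulr_suml; apply: eq_bigr => t _.
  rewrite gcoefZ gcoef_tens !gcoef_idem /= [X in _ = _ * X]mulrACA [RHS]mulrCA [RHS]mulrC.
  by rewrite -[X in X * _ = _]mulrA [t _ * _]mulrC.
have bv s : \sum_t b s t * t v^-1%g = #|A|%:R * \sum_g s g * r g v.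
  under eq_bigr do rewrite form_swap.
  rewrite (reindex_inj invg_inj) /=; under eq_bigr do rewrite invgK ffunE.
  rewrite sum_form_lchar /rho; congr (_ * _); apply: eq_bigr => g _.
  by rewrite mulrC /r (Rtwist_skew tF g).
under eq_bigr do rewrite bv.
rewrite -mulr_suml; under eq_bigr do rewrite -mulrA mulr_suml.
rewrite -mulr_sumr exchange_big (bigD1 u) //= [X in _ + X]big1 ?addr0.
  under eq_bigr do rewrite mulrAC.
  rewrite -mulr_suml (sum_lchar_mulV char0 twist_support_abelian) eqxx /=.
  have [uA|uA] := boolP (u \in A); last by rewrite supportl // !mulr0 mul0r.
  by rewrite mulr1 mulrA mulrAC mulrACA divff // mulr1 mul1r.
move=> g /negPf gu; under eq_bigr do rewrite mulrAC.
by rewrite -mulr_suml (sum_lchar_mulV char0 twist_support_abelian) gu mulr0 mul0r.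
Qed.

End FormOfTwist.

Lemma Rtwist_form_pair (k : closedFieldType) (G : finGroupType) (F : inv_twist k G) :
  [pchar k] =i pred0 -> exists p : form_pair k G, Rtwist F = Rmat (@fp_form _ _ p).
Proof.
move=> char0; exists (FormPair (twist_support_abelian (twistP F))
  (twist_support_normal (twistP F)) (twist_formP char0 (twistP F))).
exact: Rtwist_Rmat.
Qed.

(** * Symmetric invariant twists *)

Section SymmetricTwist.
Variables (k : closedFieldType) (G : finGroupType) (J : galg k (G * G)%type).
Hypotheses (tJ : is_inv_twist J) (symJ : flip J = J).
Implicit Types (x y a : galg k G) (X Y : galg k (G * G)%type) (g h : G).

Let uJ : J \is a GRing.unit. Proof. by case: tJ => [[]]. Qed.

Lemma gcoef_gelt_mul (K : finGroupType) (g h : K) (x : galg k K) :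
  gcoef (gelt g * x) h = gcoef x (g^-1 * h)%g.
Proof.
rewrite gcoef_mul (bigD1 g) //= big1 ?addr0 => [|y /negPf yg].
  by rewrite gcoef_gelt eqxx mul1r.
by rewrite gcoef_gelt yg mul0r.
Qed.

Let slice g : galg k (G * G)%type -> galg k G := contract (fun h => (h == g)%:R).

Let gcoef_slice g X h : gcoef (slice g X) h = gcoef X (g, h).
Proof.
rewrite gcoef_contract (bigD1 g) //= big1 ?addr0 => [|y /negPf yg].
  by rewrite eqxx mul1r.
by rewrite yg mul0r.
Qed.

Let T g : 'End(galg k G) := (linfun (slice g) \o amulr J \o linfun (@coprod k G))%VF.

Let TE g x : T g x = slice g (coprod x * J).
Proof. by rewrite !comp_lfunE !lfunE. Qed.

Let slice_id_coprod X g h l :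
  gcoef (id_coprod X * leg23 J) (g, h, l) = gcoef (coprod (slice g X) * J) (h, l).
Proof.
rewrite (galgE X) /id_coprod /slice /coprod !linear_sum !mulr_suml !gcoef_sum.
apply: eq_bigr => -[p q] _; rewrite !linearZ /= -!scalerAl !gcoefZ; congr (_ * _).
rewrite gext_gelt gcoef_gelt_mul [LHS](gcoef_leg23 J (p^-1 * g) (q^-1 * h) (q^-1 * l)).
have -> : contract (fun h => (h == g)%:R) (gelt (p, q)) = (p == g)%:R *: gelt q :> galg k G.
  rewrite -tens_gelt contract_tens (bigD1 p) //= big1 ?addr0 => [|y /negPf yp].
    by rewrite gcoef_gelt eqxx mulr1.
  by rewrite gcoef_gelt yp mulr0.
rewrite linearZ /= gext_gelt -scalerAl gcoefZ gcoef_gelt_mul.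
by rewrite -eq_mulVg1.
Qed.

(** By the cocycle identity and invariance, both composites read off coefficients of the same tensor
    [Y], with the first two positions exchanged; [Y] is fixed by that exchange because J is
    symmetric. *)
Let T_comm g h x : T g (T h x) = T h (T g x).
Proof.
pose Y := id_coprod (coprod x) * (leg12 J * coprod_id J).
have TTE g' h' l : gcoef (T g' (T h' x)) l = gcoef Y (h', g', l).
  rewrite TE gcoef_slice TE -slice_id_coprod id_coprodM -mulrA; congr (gcoef (_ * _) _).
  by rewrite (leg23_id_coprod _ tJ.2) -tJ.1.2.
pose sw := gext (fun t : G * G * G => (t.1.2, t.1.1, t.2)) : galg k _ -> galg k _.
have swM : {morph sw : X Y / X * Y} by apply: gextM => -[[? ?] ?] [[? ?] ?].
have swY : sw Y = Y.
  rewrite /Y !swM; congr (_ * (_ * _)).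
  - by rewrite /sw /id_coprod /coprod !gext_comp.
  - by rewrite -[in RHS]symJ /sw /leg12 /flip !gext_comp.
  - by rewrite /sw /coprod_id !gext_comp.
apply: galgP => l; rewrite !TTE -[in LHS]swY.
rewrite (gcoef_gext Y (P := xpredT) (f' := fun t => (t.1.2, t.1.1, t.2))) ?mul1r // => -[[p q] t].
by rewrite /= !xpair_eqE [(g == _) && _]andbC.
Qed.

Let exists_group_like : exists2 a, a != 0 & coprod a * J = tens a a.
Proof.
have [|||a [_ a0 aP]] := @common_eigenvector k (galg k G) G T fullv.
- by move=> g h x; apply: T_comm.
- by move=> g; apply: subvf.
- by apply/eqP => V0; have := memvf (1 : galg k G); rewrite V0 memv0 oner_eq0.
have {aP} [c cP] : exists c : G -> k, forall g h, gcoef (coprod a * J) (g, h) = c g * gcoef a h.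
  exists (fun g => projT1 (cid (aP g))) => g h; case: cid => c /= cE.
  by rewrite -gcoef_slice -TE cE gcoefZ.
have [h0 ah0] : exists h, gcoef a h != 0.
  apply/existsP; apply: contraR a0; rewrite negb_exists => /forallP aP.
  by apply/eqP/galgP => g; have := aP g; rewrite negbK => /eqP->; rewrite /gcoef ffunE.
(* So far Delta(a) J = c (x) a. Its symmetry forces c to be a multiple of a, and comparing at h0
   gives the factor l. *)
pose l := c h0 / gcoef a h0.
have aJ : coprod a * J = l *: tens a a.
  apply: galgP => -[g h]; rewrite cP gcoefZ gcoef_tens /= mulrA; congr (_ * _).
  apply: (mulIf ah0); rewrite -cP /l mulrAC divfK // -cP -gcoef_flip.
  by rewrite flipM flip_coprod symJ.
(* J is invertible and id (x) eps recovers a from Delta(a), so Delta(a) J cannot vanish. *)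
have l0 : l != 0.
  apply: contra a0 => /eqP l0; move: aJ; rewrite l0 scale0r => /(congr1 (fun X => X * J^-1)).
  rewrite mul0r mulrK // => /(congr1 (gext (fun p : G * G => p.1))).
  by rewrite /coprod gext_comp linear0 [X in X = _](_ : _ = a) => [->//|]; rewrite [RHS]galgE.
exists (l *: a); first by rewrite scaler_eq0 negb_or l0.
by rewrite tensZl tensZr /coprod linearZ /= -scalerAl aJ scalerA.
Qed.

Lemma gext_tens (K : finGroupType) (f : G * G -> K) x y :
  gext f (tens x y) = \sum_g \sum_h (gcoef x g * gcoef y h) *: gelt (f (g, h)).
Proof.
rewrite tensE linear_sum; apply: eq_bigr => g _; rewrite linear_sum; apply: eq_bigr => h _.
by rewrite linearZ /= gext_gelt.
Qed.

(* Applying the counit to Delta(a) J = a (x) a gives eps(a) <> 0; applying     *)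
(* m (S (x) id) and m (id (x) S) then gives inverses of a up to the scalar     *)
(* eps(a), since J commutes with Delta(a).                                     *)
Let group_like_unit a : a != 0 -> coprod a * J = tens a a -> a \is a GRing.unit.
Proof.
move=> a0 aJ; pose eps := \sum_g gcoef a g.
have eps0 : eps != 0.
  apply: contra a0 => /eqP e0; have m2 : {morph (fun p : G * G => p.2) : x y / (x * y)%g} by [].
  have uJ2 : gext (fun p : G * G => p.2) J \is a GRing.unit := gext_unit m2 uJ.
  have := congr1 (gext (fun p : G * G => p.2)) aJ.
  rewrite (gextM m2) /coprod gext_comp [gext _ a](_ : _ = a); last by rewrite [RHS]galgE.
  rewrite gext_tens exchange_big /= big1 => [aJ0|h _].
    by apply/eqP/(mulIr uJ2); rewrite aJ0 mul0r.
  by rewrite -scaler_suml -mulr_suml [X in X * _]e0 mul0r scale0r.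
have coE : coprod a = J^-1 * tens a a by rewrite -aJ tJ.2 mulKr.
have coE' : coprod a = tens a a * J^-1 by rewrite -aJ mulrK.
have left : gext (fun p : G * G => p.1^-1 * p.2)%g (coprod a) = eps *: 1.
  rewrite /coprod gext_comp /eps scaler_suml; apply: eq_bigr => g _ /=.
  by rewrite mulVg.
have right : gext (fun p : G * G => p.1 * p.2^-1)%g (coprod a) = eps *: 1.
  rewrite /coprod gext_comp /eps scaler_suml; apply: eq_bigr => g _ /=.
  by rewrite mulgV.
(* The map m (S (x) id) carries right multiplication by a (x) a to X |-> S(a) X a; [rightE] is the
   mirror statement. *)
have leftE Y : gext (fun p : G * G => p.1^-1 * p.2)%g (Y * tens a a) =
    antipode a * gext (fun p : G * G => p.1^-1 * p.2)%g Y * a.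
  rewrite (galgE Y) mulr_suml !linear_sum mulr_sumr mulr_suml; apply: eq_bigr => -[p q] _.
  rewrite -scalerAl !linearZ /= -scalerAr -scalerAl gext_gelt /=; congr (_ *: _).
  rewrite tensE mulr_sumr linear_sum /antipode /gext !mulr_suml; apply: eq_bigr => g _.
  rewrite mulr_sumr linear_sum [in RHS](galgE a) mulr_sumr; apply: eq_bigr => h _.
  rewrite -scalerAr linearZ /= -geltM [gext _ _]gext_gelt -!scalerAl -scalerAr scalerA -!geltM /=.
  by rewrite invMg !mulgA -(galgE a).
have rightE Y : gext (fun p : G * G => p.1 * p.2^-1)%g (tens a a * Y) =
    a * gext (fun p : G * G => p.1 * p.2^-1)%g Y * antipode a.
  rewrite (galgE Y) mulr_sumr linear_sum [X in a * X]linear_sum.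
  rewrite [X in _ = X * _]mulr_sumr [RHS]mulr_suml; apply: eq_bigr => -[p q] _.
  rewrite -scalerAr !linearZ /= -scalerAr -scalerAl gext_gelt /=; congr (_ *: _).
  rewrite tensE mulr_suml linear_sum [in RHS](galgE a) !mulr_suml.
  rewrite -[in antipode _](galgE a); apply: eq_bigr => g _.
  rewrite mulr_suml linear_sum /antipode [gext _ a]/gext [RHS]mulr_sumr; apply: eq_bigr => h _.
  rewrite -scalerAl linearZ /= -geltM [gext _ _]gext_gelt -!scalerAl -scalerAr scalerA -!geltM /=.
  by rewrite invMg !mulgA.
pose b := eps^-1 *: (antipode a * gext (fun p : G * G => p.1^-1 * p.2)%g J^-1).
pose c := eps^-1 *: (gext (fun p : G * G => p.1 * p.2^-1)%g J^-1 * antipode a).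
have ba : b * a = 1 by rewrite -scalerAl -leftE -coE left scalerA mulVf // scale1r.
have ac : a * c = 1 by rewrite -scalerAr mulrA -rightE -coE' right scalerA mulVf // scale1r.
have bc : b = c by rewrite -[b]mulr1 -ac mulrA ba mul1r.
by apply/unitrP; exists b; rewrite {2}bc.
Qed.

(** Since Delta(a) = (a (x) a) J^-1 and J commutes with Delta(g), the conjugate x = a g a^-1
    satisfies Delta(x) = x (x) x, hence is an element of G by [delta_eq1]. The resulting map on G is
    injective, so bijective by finiteness. *)
Lemma symmetric_twist_delta : exists2 a, normalizes a & J = delta a.
Proof.
have [a a0 aJ] := exists_group_like; have ua := group_like_unit a0 aJ.
have uco : coprod a \is a GRing.unit by apply: gext_unit.
have VE : coprod a^-1 = (coprod a)^-1 by apply: gextV.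
have JE : J = delta a by rewrite /delta -aJ VE tJ.2 mulrK.
have conjE g : exists h, a * gelt g = gelt h * a.
  have ux : a * gelt g * a^-1 \is a GRing.unit.
    by rewrite !unitr_mul ?unitrV //; have [] := geltV k g.
  have [|h hE] := delta_eq1 ux; last by exists h; rewrite -hE mulrVK.
  have [uaa aaV] := tens_unit ua.
  have coE : coprod a = tens a a * J^-1 by rewrite -aJ mulrK.
  have coV : coprod a^-1 = J * tens a^-1 a^-1 by rewrite VE coE invrM ?unitrV // invrK aaV.
  have coX : coprod (a * gelt g * a^-1) = tens (a * gelt g * a^-1) (a * gelt g * a^-1).
    rewrite !coprodM coE coV !mulrA -(mulrA _ _ J) tJ.2 mulrA (mulrVK uJ) coprod_gelt.
    by rewrite -tens_gelt !tensM.
  have uco' : coprod (a * gelt g * a^-1) \is a GRing.unit by apply: gext_unit.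
  have VX : coprod (a * gelt g * a^-1)^-1 = (coprod (a * gelt g * a^-1))^-1 by apply: gextV.
  by rewrite /delta VX -coX divrr.
exists a => //; pose s g := projT1 (cid (conjE g)).
have sE g : a * gelt g = gelt (s g) * a by rewrite /s; case: cid.
have sI : injective s.
  by move=> g h gh; apply: (@gelt_inj k); apply: (mulrI ua); rewrite !sE gh.
apply: normalizes_of => // g; exists (invF sI g).
by rewrite sE f_invF.
Qed.

End SymmetricTwist.

(** * Bicharacter twists *)

Lemma gext_comm (k : fieldType) (G K : finGroupType) (f f' : G -> K) (X Y : galg k G) :
  (forall p q, gcoef X p != 0 -> gcoef Y q != 0 -> (f p * f' q)%g = (f' q * f p)%g) ->
  gext f X * gext f' Y = gext f' Y * gext f X.
Proof.
move=> ff'; rewrite /gext !mulr_suml; under eq_bigr do rewrite mulr_sumr.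
rewrite exchange_big; apply: eq_bigr => q _ /=; rewrite mulr_sumr; apply: eq_bigr => p _.
rewrite -!scalerAl -!scalerAr !scalerA -!geltM mulrC.
have [->|Yq] := eqVneq (gcoef Y q) 0; first by rewrite !mul0r !scale0r.
have [->|Xp] := eqVneq (gcoef X p) 0; first by rewrite !mulr0 !scale0r.
by rewrite ff'.
Qed.

Section Bicharacter.
Variables (k : closedFieldType) (G : finGroupType) (A : {group G}).
Hypotheses (char0 : [pchar k] =i pred0) (abA : abelian A) (nA : (A <| [set: G])%g).
Implicit Types (s t : lchar k A) (c d : lchar k A -> lchar k A -> k) (x : G).

Let A0 : #|A|%:R != 0 :> k.
Proof. by rewrite (natr_neq0 char0) ?cardG_gt0. Qed.

(** The e_s (x) e_t are orthogonal idempotents, so products are computed pointwise on the forms. *)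
Lemma RmatM c d : Rmat c * Rmat d = Rmat (fun s t => c s t * d s t).
Proof.
rewrite /Rmat mulr_suml; apply: eq_bigr => s _; rewrite mulr_suml; apply: eq_bigr => t _.
rewrite mulr_sumr (bigD1 s) //= [X in _ + X]big1 ?addr0 => [|s' /negPf s's]; last first.
  rewrite mulr_sumr big1 // => t' _; rewrite -scalerAl -scalerAr tensM (idemM char0).
  by rewrite eq_sym s's scale0r tensE big1 ?scaler0 // => g _; rewrite big1 // => h _;
    rewrite /gcoef ffunE mul0r scale0r.
rewrite mulr_sumr (bigD1 t) //= [X in _ + X]big1 ?addr0 => [|t' /negPf t't]; last first.
  rewrite -scalerAl -scalerAr tensM !(idemM char0).
  by rewrite [t == _]eq_sym t't tensZr !scale0r !scaler0.
by rewrite -scalerAl -scalerAr tensM !(idemM char0) !eqxx !scale1r scalerA.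
Qed.

Lemma Rmat1 : Rmat (fun _ _ : lchar k A => 1) = 1.
Proof.
rewrite /Rmat; apply: galgP => -[g h]; rewrite -tens1 gcoef_tens /= -!(sum_idem char0 abA).
rewrite !gcoef_sum mulr_suml; apply: eq_bigr => s _; rewrite gcoef_sum mulr_sumr.
by apply: eq_bigr => t _; rewrite scale1r gcoef_tens.
Qed.

Lemma flip_Rmat c : flip (Rmat c) = Rmat (fun s t => c t s).
Proof.
apply: galgP => -[g h]; rewrite gcoef_flip /Rmat !gcoef_sum.
under eq_bigr do rewrite gcoef_sum; rewrite exchange_big; apply: eq_bigr => s _.
rewrite gcoef_sum; apply: eq_bigr => t _.
by rewrite !gcoefZ !gcoef_tens /= [X in _ * X]mulrC.
Qed.

Lemma lchar_conjK x : cancel (fun s => lchar_conj s x) (fun s => lchar_conj s x^-1%g).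
Proof.
have NA y : y \in 'N(A)%g.
  by apply: (fintype.subsetP (normal_norm nA)); rewrite finset.in_setT.
by move=> s; apply: lchar_eqP => g _; rewrite /= !ffunE !NA invgK conjgK.
Qed.

Lemma Rmat_invariant c :
  (forall x s t, c (lchar_conj s x) (lchar_conj t x) = c s t) -> is_invariant (Rmat c).
Proof.
move=> cI; apply: comm_ext => x; have conjI := can_inj (@lchar_conjK x).
rewrite /Rmat mulr_sumr mulr_suml (reindex_inj conjI) /=.
apply: eq_bigr => s _; rewrite mulr_sumr mulr_suml (reindex_inj conjI) /=.
apply: eq_bigr => t _; rewrite -scalerAl -scalerAr -tens_gelt !tensM cI.
by rewrite !idem_conj // !lchar_conjK.
Qed.

(** R is the sum of the [E t] (x) e_t. Multiplicativity of c gives Delta(E_t) = E_t (x) E_t, which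
    is [EE], and e_t e_t' collapses the double sum on the right. *)
Lemma coprod_id_Rmat c : (forall s s' t, c (s * s')%g t = c s t * c s' t) ->
  coprod_id (Rmat c) = leg13 (Rmat c) * leg23 (Rmat c).
Proof.
move=> cM; pose E t : galg k G := \sum_s c s t *: idem s.
have RE g h : gcoef (Rmat c) (g, h) = \sum_t gcoef (E t) g * gcoef (idem t) h.
  rewrite gcoef_sum; under eq_bigr do rewrite gcoef_sum.
  rewrite exchange_big; apply: eq_bigr => t _; rewrite gcoef_sum mulr_suml.
  by apply: eq_bigr => s _; rewrite !gcoefZ gcoef_tens mulrA.
have EE t g h : gcoef (E t) g * gcoef (E t) h = (g == h)%:R * gcoef (E t) g.
  rewrite /E !gcoef_sum mulr_suml.
  transitivity (\sum_(s : lchar k A) \sum_(s' : lchar k A)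
    #|A|%:R^-1 * #|A|%:R^-1 * c s' t * s' h^-1%g * (s g^-1%g * s (h^-1)^-1%g)).
    (* Replacing s' by s^-1 s' merges the two values of c into one that is independent of s, so the
       sum over s falls under orthogonality. *)
    apply: eq_bigr => s _; rewrite mulr_sumr (reindex_inj (mulgI s^-1%g)) /=.
    apply: eq_bigr => s' _; rewrite !gcoefZ !gcoef_idem lchar_mulE lchar_invE.
    have -> : c s' t = c s t * c (s^-1 * s')%g t by rewrite -cM mulKVg.
    by ring.
  rewrite exchange_big mulr_sumr; apply: eq_bigr => s _ /=.
  rewrite -mulr_sumr (sum_lchar_mulV char0 abA) (inj_eq invg_inj) groupV gcoefZ gcoef_idem.
  have [<-|_] := eqVneq g h; last by rewrite !mulr0 mul0r.
  have [gA|gA] := boolP (g \in A); last by rewrite [s g^-1%g]lchar0 ?groupV // !(mulr0, mul0r).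
  by rewrite mulr1 mul1r; field.
apply: galgP => -[[g g'] h]; rewrite gcoef_leg13_leg23 gcoef_coprod_id.
transitivity (\sum_t \sum_t' gcoef (E t) g * gcoef (E t') g' * gcoef (idem t * idem t') h).
  rewrite RE mulr_sumr; apply: eq_bigr => t _.
  rewrite (bigD1 t) //= [X in _ + X]big1 ?addr0 => [|t' /negPf t't].
    by rewrite (idemM char0) eqxx scale1r EE mulrA.
  by rewrite (idemM char0) eq_sym t't scale0r [X in _ * X]/gcoef ffunE mulr0.
transitivity (\sum_y \sum_t \sum_t' (gcoef (E t) g * gcoef (idem t) y) *
   (gcoef (E t') g' * gcoef (idem t') (y^-1 * h)%g)); last first.
  apply: eq_bigr => y _; rewrite !RE mulr_suml; apply: eq_bigr => t _.
  by rewrite mulr_sumr.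
rewrite [RHS]exchange_big; apply: eq_bigr => t _.
rewrite [RHS]exchange_big; apply: eq_bigr => t' _ /=.
by rewrite gcoef_mul mulr_sumr; apply: eq_bigr => y _; rewrite mulrACA.
Qed.

Lemma Rmat_support c (p : G * G) : gcoef (Rmat c) p != 0 -> (p.1 \in A) && (p.2 \in A).
Proof.
apply: contraR => pA; rewrite gcoef_sum big1 // => s _; rewrite gcoef_sum big1 // => t _.
rewrite gcoefZ gcoef_tens !gcoef_idem; move: pA; rewrite negb_and => /orP[pA|pA].
  by rewrite [s _]lchar0 ?groupV // !(mulr0, mul0r).
by rewrite [t _]lchar0 ?groupV // !(mulr0, mul0r).
Qed.

Lemma id_coprod_Rmat c : (forall s t t', c s (t * t')%g = c s t * c s t') ->
  id_coprod (Rmat c) = leg12 (Rmat c) * leg13 (Rmat c).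
Proof.
move=> cM; pose cyc := gext (fun t : G * G * G => (t.2, t.1.1, t.1.2)) : galg k _ -> galg k _.
have cycM : {morph cyc : X Y / X * Y} by apply: gextM => -[[? ?] ?] [[? ?] ?].
have := congr1 cyc (@coprod_id_Rmat (fun s t => c t s) (fun s s' t => cM t s s')).
rewrite -flip_Rmat cycM /cyc /leg12 /leg13 /leg23 /coprod_id /id_coprod /flip !gext_comp.
by [].
Qed.

(** Both sides of the cocycle identity are products of R_12, R_13 and R_23, which commute because A
    is abelian. *)
Lemma bicharacter_inv_twist c : (forall s t, c s t != 0) ->
  (forall s s' t, c (s * s')%g t = c s t * c s' t) ->
  (forall s t t', c s (t * t')%g = c s t * c s t') ->
  (forall x s t, c (lchar_conj s x) (lchar_conj t x) = c s t) ->
  is_inv_twist (Rmat c).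
Proof.
move=> c0 cMl cMr cI; split; last exact: Rmat_invariant.
split.
  apply/unitrP; exists (Rmat (fun s t => (c s t)^-1)); rewrite !RmatM -Rmat1.
  by split; congr Rmat; apply: funext => s; apply: funext => t; rewrite ?mulVf ?divff.
have comm f f' : (forall p q : G * G, (p.1 \in A) && (p.2 \in A) -> (q.1 \in A) && (q.2 \in A) ->
    (f p * f' q = f' q * f p :> G * G * G)%g) ->
    gext f (Rmat c) * gext f' (Rmat c) = gext f' (Rmat c) * gext f (Rmat c).
  by move=> ff'; apply: gext_comm => p q /Rmat_support pA /Rmat_support qA; apply: ff'.
have abC x y : x \in A -> y \in A -> (x * y = y * x)%g by move=> xA yA; apply: (centsP abA).
have C12 : leg23 (Rmat c) * leg12 (Rmat c) = leg12 (Rmat c) * leg23 (Rmat c).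
  apply: comm => -[p1 p2] [q1 q2] /= /andP[? ?] /andP[? ?].
  by congr (_, _, _); rewrite ?mulg1 ?mul1g //; apply: abC.
have C13 : leg23 (Rmat c) * leg13 (Rmat c) = leg13 (Rmat c) * leg23 (Rmat c).
  apply: comm => -[p1 p2] [q1 q2] /= /andP[? ?] /andP[? ?].
  by congr (_, _, _); rewrite ?mulg1 ?mul1g //; apply: abC.
by rewrite coprod_id_Rmat // id_coprod_Rmat // mulrA [RHS]mulrA C12 -mulrA -[RHS]mulrA C13.
Qed.

End Bicharacter.

Lemma odd_supported_twist (k : closedFieldType) (G : finGroupType) (p : form_pair k G) :
  [pchar k] =i pred0 -> odd #|G| -> exists F : inv_twist k G,
    Rtwist F = Rmat (@fp_form _ _ p) /\
    twist_val F \in tensv (subgroup_algebra k (fp_group p)) (subgroup_algebra k (fp_group p)).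
Proof.
move=> char0 oddG; case: p => A b abA nA bP /=.
have oddA : odd #|A| by apply: dvdn_odd oddG; rewrite -cardsT cardSg ?finset.subsetT.
(* As b has values of order dividing 2 m + 1, the form b^m is a square root of b^-1, and skew
   symmetry gives it the R-matrix b^(-2m) = b. *)
pose m := #|A|./2; have Am : #|A| = (m + m).+1.
  by rewrite addnn -[LHS]odd_double_half oddA.
have bX s t n : b (s ^+ n)%g t = b s t ^+ n.
  elim: n => [|n IHn]; first by rewrite expg0 (form_1l bP).
  by rewrite expgS (form_bilinear_l bP) IHn exprS.
have bA s t : b s t ^+ #|A| = 1.
  rewrite -bX [X in b X _](_ : _ = 1%g) ?(form_1l bP) //; apply: lchar_eqP => g gA.
  have sX n : (s ^+ n)%g g = s (g ^+ n)%g.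
    elim: n => [|n IHn]; first by rewrite !expg0 lchar1 lchar_1E gA.
    by rewrite !expgS lchar_mulE IHn lcharM ?groupX.
  by rewrite sX expg_cardG // lchar1 lchar_1E gA.
pose c s t := b s t ^+ m.
have cP : is_inv_twist (Rmat c).
  apply: bicharacter_inv_twist => // [s t|s s' t|s t t'|x s t]; rewrite /c.
  - by rewrite expf_neq0 // (form_neq0 bP).
  - by rewrite (form_bilinear_l bP) exprMn.
  - by rewrite (form_bilinear_r bP) exprMn.
  - by rewrite (form_invariant bP).
exists (InvTwist cP) => /=; split; last by rewrite Rmat_tensv.
have uc := cP.1.1; apply: (mulIr uc); rewrite /Rtwist mulrVK // flip_Rmat RmatM //.
congr Rmat; apply: funext => s; apply: funext => t; rewrite /c (form_skew bP s t) exprVn.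
have bm0 : b s t ^+ m != 0 by rewrite expf_neq0 // (form_neq0 bP).
by apply: (mulfI bm0); rewrite divff // mulrCA -exprD -exprS -Am bA.
Qed.

(** * The fibres of Theta *)

Section Fibres.
Variables (k : closedFieldType) (G : finGroupType).
Hypothesis char0 : [pchar k] =i pred0.
Implicit Types (F : inv_twist k G) (p : form_pair k G).

(** A pair exists by [Rtwist_form_pair], so the choice in [Theta_twist] never falls back on its
    default; uniqueness is [eq_form_pair]. *)
Lemma Theta_classP F p : Theta (H2class F) = p <-> Rtwist F = Rmat (@fp_form _ _ p).
Proof.
have ThF : Rtwist F = Rmat (@fp_form _ _ (Theta (H2class F))).
  apply/(is_ThetaP char0); rewrite Theta_class; apply: xgetPex.
  by have [q qF] := Rtwist_form_pair F char0; exists q; apply/(is_ThetaP char0).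
by split=> [<- //|RF]; apply: (eq_form_pair char0); rewrite -ThF.
Qed.

Lemma Rtwist_eqP F F' : Rtwist F = Rtwist F' <->
  exists2 a, normalizes a & twist_val F' = twist_val F * delta a.
Proof.
have [tF tF'] := (twistP F, twistP F'); have [uF uF'] := (tF.1.1, tF'.1.1).
have ufF := flip_unit uF; split=> [RF|[a Na FE]].
  have tJ : is_inv_twist ((twist_val F)^-1 * twist_val F').
    by apply: inv_twistM => //; apply: inv_twistV.
  have symJ : flip ((twist_val F)^-1 * twist_val F') = (twist_val F)^-1 * twist_val F'.
    rewrite flipM flipV //; apply: (mulrI ufF); rewrite mulVKr //.
    by rewrite mulrA [_ * _^-1]RF /Rtwist mulrVK.
  have [a Na JE] := symmetric_twist_delta tJ symJ.
  by exists a; rewrite // -JE mulVKr.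
have ud := delta_unit Na.1.
by rewrite /Rtwist FE flipM flip_delta (invrM uF ud) -mulrA (mulVKr ud).
Qed.

Lemma Theta_eqP (x y : H2l k G) : Theta y = Theta x <->
  exists2 u, u \in @IntInn_H2 k G & y = (x * u)%g.
Proof.
rewrite -(H2reprK x) -(H2reprK y); move: (H2repr x) (H2repr y) => F F'; split.
  move=> /Theta_classP RF'; have RF : Rtwist F = Rtwist F'.
    by rewrite RF'; apply/Theta_classP.
  have [a Na FE] := (Rtwist_eqP F F').1 RF.
  exists (H2class (delta_twist Na)); first by apply/mem_set; exists a, Na.
  by rewrite -[RHS]H2classM; congr H2class; apply: twist_val_inj.
move=> [_ /set_mem[a [Na ->]]]; rewrite -[(_ * _)%g]H2classM => ->.
apply/Theta_classP; rewrite -(Rtwist_eqP F _).2; first exact/Theta_classP.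
by exists a.
Qed.

(** The trivial twist has R = 1, which is the R-matrix of the trivial pair, so this is the fibre
    through the unit class. *)
Lemma Theta1P (x : H2l k G) : Theta x = form_pair1 k G <-> x \in @IntInn_H2 k G.
Proof.
have Th1 : Theta (1%g : H2l k G) = form_pair1 k G.
  apply/Theta_classP; rewrite /Rtwist /= /flip gext1 // invr1 mulr1.
  by rewrite (Rmat1 char0 (abelian1 G)).
rewrite -Th1 Theta_eqP; split=> [[u uI ->]|xI]; first by rewrite mul1g.
by exists x; rewrite ?mul1g.
Qed.

Lemma IntInn_H2_1 : 1%g \in @IntInn_H2 k G.
Proof.
apply/mem_set; exists 1, (normalizes1 k G); congr H2class; apply: twist_val_inj.
by rewrite /= delta1.
Qed.

Lemma IntInn_H2_M (x y : H2l k G) :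
  x \in @IntInn_H2 k G -> y \in @IntInn_H2 k G -> (x * y)%g \in @IntInn_H2 k G.
Proof.
move=> /set_mem[a [Na ->]] /set_mem[b [Nb ->]]; apply/mem_set.
exists (a * b), (normalizesM Na Nb); rewrite -[LHS]H2classM; congr H2class.
by apply: twist_val_inj; rewrite /= (deltaM Na.1 Nb).
Qed.

Lemma IntInn_H2_V (x : H2l k G) : x \in @IntInn_H2 k G -> x^-1%g \in @IntInn_H2 k G.
Proof.
move=> /set_mem[a [Na ->]]; apply/mem_set; exists a^-1, (normalizesV Na).
apply: (mulgI (H2class (delta_twist Na))); rewrite mulgV -[RHS]H2classM.
by congr H2class; apply: twist_val_inj; rewrite /= (deltaV Na) divrr // delta_unit // Na.1.
Qed.

End Fibres.

(** * Fibres, kernel and surjectivity of Theta *)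

Local Open Scope classical_set_scope.
Local Open Scope group_scope.

Theorem theorem4p5 (k : closedFieldType) (G : finGroupType)
  (hchar : [pchar k]%R =i pred0) :
  [/\ (* (a) *)
      forall x : H2l k G,
        @Theta k G @^-1` [set Theta x] = [set x * u | u in @IntInn_H2 k G],
      (* (b) *)
      [/\ Theta (1 : H2l k G) = form_pair1 k G,
          forall x y : H2l k G, Theta x = form_pair1 k G ->
            Theta y = form_pair1 k G -> Theta (x * y) = form_pair1 k G,
          forall x : H2l k G, Theta x = form_pair1 k G ->
            Theta x^-1 = form_pair1 k G
        & exists f : coset_of (Inn G) -> H2l k G,
            [/\ {in Intk k G / Inn G &, {morph f : s t / s * t}},
                {in Intk k G / Inn G &, injective f}
              & f @` [set` Intk k G / Inn G] =
                @Theta k G @^-1` [set form_pair1 k G]]]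
    & (* (c) *)
      odd #|G| ->
        (forall p : form_pair k G, exists F : inv_twist k G,
           supported F (fp_group p) /\ Theta (H2class F) = p) /\
        (forall p : form_pair k G, exists x : H2l k G, Theta x = p)].
Proof.
split.
- move=> x; apply/seteqP; split=> [y /= /(Theta_eqP hchar)[u uI ->]|_ [u uI <-]].
    by exists u => //; apply: set_mem.
  by apply/(Theta_eqP hchar); exists u => //; apply: mem_set.
- have [f [fM fI fT _]] := Intk_Inn_embedding k G.
  split; first exact/(Theta1P hchar)/IntInn_H2_1.
  + move=> x y /(Theta1P hchar) xI /(Theta1P hchar) yI.
    exact/(Theta1P hchar)/IntInn_H2_M.
  + by move=> x /(Theta1P hchar) xI; apply/(Theta1P hchar)/IntInn_H2_V.
  (* The image of the embedding of Int_k(G) / Inn(G) is [IntInn_H2], identified with the fibre over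
     1 by [Theta1P]. *)
  + exists f; split=> //; rewrite fT; apply/seteqP; split=> x /=.
      by move=> xI; apply/(Theta1P hchar)/mem_set.
    by move/(Theta1P hchar)/set_mem.
- move=> oddG; have main : forall p : form_pair k G, exists F : inv_twist k G,
      supported F (fp_group p) /\ Theta (H2class F) = p.
    move=> p; have [F [RF Fp]] := odd_supported_twist p hchar oddG.
    have ThF : Theta (H2class F) = p by apply/(Theta_classP hchar).
    by exists F; split=> //; split=> //; rewrite -Theta_class ThF.
  by split=> // p; have [F [_ ThF]] := main p; exists (H2class F).
Qed.
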